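(* Let $q$ be a prime power, let $n,k,s$ be positive integers with $n \geq 2k$, write $n = mk + r$ with integers $m$ and $0 \leq r < k$, and let $\ell$ be the integer with $[\ell-1] < s \leq [\ell]$, where $[a] = \frac{q^a-1}{q-1}$. Let $Y$ be a largest $s$-EM family of $k$-spaces in $\mathbb{F}_q^n$. If $$16 s \leq \min\left\{ q^{\frac{n-k-\ell+2}{3}},\ q^{\frac{n-k-r}{3}},\ q^{\frac{n}{2}-k+1} \right\},$$ then $Y$ is the union of $s$ intersecting families.
   Context: A $k$-space is a $k$-dimensional subspace of $\mathbb{F}_q^n$. Two subspaces are called disjoint if their intersection is the trivial subspace $\{0\}$; two subspaces ''meet'' if they are not disjoint. A family of $k$-spaces is an $s$-EM family if it does not contain $s+1$ pairwise disjoint members. A family of $k$-spaces is intersecting if any two of its members meet (intersect nontrivially). ''Largest'' means of maximum cardinality among all $s$-EM families of $k$-spaces in $\mathbb{F}_q^n$. *)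

(* Defs.v *)
From HB Require Import structures.
From mathcomp Require Import all_boot all_order all_algebra.
From mathcomp Require Import reals exp.
Import VectorInternalTheory.
Set Implicit Arguments.
Unset Strict Implicit.
Unset Printing Implicit Defensive.
Import Order.TTheory GRing.Theory Num.Theory.
Local Open Scope ring_scope.

(* A finite-dimensional space over a finite field has finitely many subspaces,
   so families of subspaces can be taken in [{set {vspace vT}}]. *)
HB.instance Definition _ (F : finFieldType) (vT : vectType F) :=
  [Countable of {vspace vT} by <:].
HB.instance Definition _ (F : finFieldType) (vT : vectType F) :=
  [Finite of {vspace vT} by <:].

Definition gauss_nat (R : numFieldType) (q : R) (a : int) : R :=
  (q ^ a - 1) / (q - 1).

Section Families.
Variables (F : finFieldType) (n : nat).
Local Notation V := 'rV[F]_n.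

Definition disjointv (U W : {vspace V}) : Prop := (U :&: W)%VS = 0%VS.

Definition meetv (U W : {vspace V}) : Prop := ~ disjointv U W.

Definition kspace_family (k : nat) (A : {set {vspace V}}) : Prop :=
  forall U, U \in A -> \dim U = k.

Definition pairwise_disjointv (A : {set {vspace V}}) : Prop :=
  forall U W, U \in A -> W \in A -> U <> W -> disjointv U W.

Definition EM_family (s k : nat) (Y : {set {vspace V}}) : Prop :=
  kspace_family k Y /\
  ~ (exists A : {set {vspace V}},
       [/\ A \subset Y, #|A| = s.+1 & pairwise_disjointv A]).

Definition largest_EM_family (s k : nat) (Y : {set {vspace V}}) : Prop :=
  EM_family s k Y /\
  forall Z : {set {vspace V}}, EM_family s k Z -> (#|Z| <= #|Y|)%N.

(* [U] and [W] may coincide: a k-space with k > 0 meets itself. *)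
Definition intersecting_family (k : nat) (A : {set {vspace V}}) : Prop :=
  kspace_family k A /\
  forall U W, U \in A -> W \in A -> meetv U W.

End Families.

(* Main.v *)
(* Let E = [n-1, k-1]_q be the number of k-spaces through a point. A pencil is
   the set of all k-spaces through a point or, when n = 2k, inside a hyperplane;
   it has E members, and a k-space outside it meets at most a fraction
   [k][k-1]/[n-1], less than 1/(15 s), of them. A largest Y has at least
   (s - 1/1000) E members, as the union of s point pencils shows. If some pencil
   contains more than s [k][k-1]/[n-1] E members of Y, removing it from Y leaves
   an (s-1)-EM family, because s pairwise disjoint members outside the pencil
   could be extended by a member of the pencil; induction on s then covers Y by
   parts of s-1 pencils and a last intersecting family.

   Such a pencil exists. If n >= 4k, the members of Y are met by the at most
   s[k] points of a maximal clique, that is, a maximal set of pairwise disjoint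
   members of Y, and one of these points works. If n < 4k, averaging over
   the images of a partial spread of q^(n-k) subspaces yields a clique of size s
   in Y whose members meet on average few members of Y; the members of Y meeting
   exactly one, suitably chosen, x in the clique form an intersecting family V
   with at least 8/9 E members. The points form a 2-design, so a second moment
   computation shows that some x in V has many members of V meeting x in
   codimension one, while most z in V meet x in a point only. A neighbour y of x
   meets such a z only if it contains the point x :&: z or lies in x + z. Two z
   with different points (and, when n = 2k, different hyperplanes x + z) would
   leave room for too few neighbours, so most of V lies in one pencil. *)
Require Import Defs.
From HB Require Import structures.
From mathcomp Require Import all_boot all_order all_fingroup all_algebra all_field.
From mathcomp Require Import reals exp.
From mathcomp Require Import zify ring lra.
Import Order.TTheory GRing.Theory Num.Theory.
Set Implicit Arguments.
Unset Strict Implicit.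
Unset Printing Implicit Defensive.
Local Open Scope ring_scope.

(** * Gaussian binomials *)

Section QNumbers.
Variables (R : realFieldType) (q : R).
Hypothesis q_gt1 : 1 < q.

Definition qnum (a : nat) : R := (q ^+ a - 1) / (q - 1).

(* For [b > a] a factor [qnum 0] makes it vanish. *)
Fixpoint gbin (a b : nat) : R :=
  if b is b'.+1 then qnum a / qnum b * gbin a.-1 b' else 1.

Lemma q_gt0 : 0 < q. Proof. exact: lt_trans q_gt1. Qed.
Lemma q1_neq0 : q - 1 != 0. Proof. by rewrite subr_eq0 gt_eqF. Qed.
Hint Resolve q_gt0 q1_neq0 : core.

Lemma qX_gt0 a : 0 < q ^+ a. Proof. exact: exprn_gt0. Qed.
Lemma qX_ge1 a : 1 <= q ^+ a. Proof. exact: exprn_ege1 (ltW q_gt1). Qed.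

Lemma qnumE a : (q - 1) * qnum a = q ^+ a - 1.
Proof. by rewrite /qnum mulrC divfK. Qed.

Lemma qnum0 : qnum 0 = 0. Proof. by rewrite /qnum expr0 subrr mul0r. Qed.
Lemma qnum1 : qnum 1 = 1. Proof. by rewrite /qnum expr1 divff. Qed.

Lemma qnumD a b : qnum (a + b) = q ^+ b * qnum a + qnum b.
Proof.
apply: (mulfI q1_neq0); rewrite mulrDr [_ * (q ^+ b * _)]mulrCA !qnumE exprD; ring.
Qed.

Lemma qnumS a : qnum a.+1 = q * qnum a + 1.
Proof. by rewrite -addn1 qnumD expr1 qnum1. Qed.

Lemma qnum_ge0 a : 0 <= qnum a.
Proof.
apply: divr_ge0; last by rewrite subr_ge0 ltW.
by rewrite subr_ge0 qX_ge1.
Qed.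

Lemma qnum_gt0 a : (0 < a)%N -> 0 < qnum a.
Proof.
by case: a => // a _; rewrite qnumS; have /= := mulr_ge0 (ltW q_gt0) (qnum_ge0 a); lra.
Qed.

Lemma qnum_neq0 a : (0 < a)%N -> qnum a != 0.
Proof. by move=> h; rewrite gt_eqF // qnum_gt0. Qed.

Lemma qnum_ge_expr a : q ^+ a <= qnum a.+1.
Proof.
rewrite -add1n qnumD qnum1 mulr1; have := qnum_ge0 a; lra.
Qed.

Lemma ler_qnum a b : (a <= b)%N -> qnum a <= qnum b.
Proof.
move=> /subnK <-; rewrite qnumD.
by have := mulr_ge0 (ltW (qX_gt0 a)) (qnum_ge0 (b - a)); lra.
Qed.

Lemma gbin0 a : gbin a 0 = 1. Proof. by case: a. Qed.

Lemma gbin_ge0 a b : 0 <= gbin a b.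
Proof.
elim: b a => [|b IH] a /=; first exact: ler01.
by rewrite mulr_ge0 // divr_ge0 // qnum_ge0.
Qed.

Lemma gbin_gt0 a b : (b <= a)%N -> 0 < gbin a b.
Proof.
elim: b a => [|b IH] [|a] //= h; rewrite ?ltr01 //.
by rewrite mulr_gt0 // ?IH // divr_gt0 // qnum_gt0.
Qed.

Lemma gbin_small a b : (a < b)%N -> gbin a b = 0.
Proof.
elim: b a => // b IH [|a] /= h; first by rewrite qnum0 !mul0r.
by rewrite IH // mulr0.
Qed.

Lemma gbin_absorb a b : gbin a b.+1 * qnum b.+1 = qnum a * gbin a.-1 b.
Proof. by rewrite /= mulrAC divfK // qnum_neq0. Qed.

Lemma gbin_absorb2 a b : (b <= a)%N -> (0 < a)%N ->
  gbin a b * qnum (a - b) = qnum a * gbin a.-1 b.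
Proof.
elim: b a => [|b IH] a h a0; first by rewrite !gbin0 subn0 mulrC.
have b0 := qnum_neq0 (ltn0Sn b).
apply: (mulIf b0); rewrite mulrAC gbin_absorb -[RHS]mulrA gbin_absorb.
rewrite -[LHS]mulrA; congr (_ * _).
have -> : (a - b.+1 = a.-1 - b)%N by lia.
case: (posnP a.-1) => a1; last by apply: IH; lia.
have -> : b = 0%N by lia.
by rewrite a1 !gbin0 qnum0 mulr0 mul0r.
Qed.

Lemma gbin_next a b : (b < a)%N ->
  gbin a b.+1 * qnum b.+1 = gbin a b * qnum (a - b).
Proof.
by move=> h; rewrite gbin_absorb -gbin_absorb2 //; lia.
Qed.

Lemma gbinn a : gbin a a = 1.
Proof.
elim: a => //= a IH; rewrite IH mulr1 divff // qnum_neq0 //.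
Qed.

Lemma gbin_pred a : gbin a.+1 a = qnum a.+1.
Proof.
have := gbin_absorb2 (leqnSn a) (ltn0Sn a).
by rewrite subSn // subnn qnum1 mulr1 gbinn mulr1.
Qed.

Lemma gbin1 a : gbin a 1 = qnum a.
Proof. by rewrite /= qnum1 divr1 mulr1. Qed.

End QNumbers.
Arguments gbin {R} q a b : simpl never.

(** * Counting subspaces *)

Section SubspaceCounts.
Variables (R : realFieldType) (F : finFieldType) (n : nat).
Local Notation V := 'rV[F]_n.
Local Notation q := (#|F|%:R : R).
Local Notation "[ a ]q" := (qnum q a) (at level 0, a at level 99).
Local Notation sp := {vspace V}.

Lemma cardF_gt1 : 1 < q.
Proof. by rewrite ltr1n finNzRing_gt1. Qed.
Hint Resolve cardF_gt1 : core.

Definition between (A B : sp) d : {set sp} :=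
  [set T : sp | [&& (A <= T)%VS, (T <= B)%VS & \dim T == d]].

Lemma dim_fullrV : \dim {:V} = n.
Proof. by rewrite dimvf /dim /= mul1n. Qed.

Lemma card_diffv (A B : sp) : (A <= B)%VS ->
  #|[pred v : V | (v \in B) && (v \notin A)]| = (#|F| ^ \dim B - #|F| ^ \dim A)%N.
Proof.
move=> AB; rewrite -!card_vspace -(cardID (mem A) (mem B)).
set x := #|_|; set y := #|_|; set z := #|_|.
have -> : y = z by apply: eq_card => v; rewrite !inE andbC.
have -> : x = #|A|; last by rewrite addKn.
apply: eq_card => v; rewrite !inE; case vA : (v \in A); rewrite ?andbF ?andbT //.
exact: (subvP AB _ vA).
Qed.

Lemma dim_add_line (A : sp) v : v \notin A -> \dim (A + <[v]>) = (\dim A).+1.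
Proof.
move=> vA; have v0 : v != 0 by apply: contra vA => /eqP->; rewrite mem0v.
rewrite dimv_disjoint_sum ?dim_vline ?v0 ?addn1 //.
apply/eqP; rewrite -subv0; apply/subvP => w; rewrite memv_cap memv0.
case/andP=> wA /vlineP[c wc]; rewrite wc.
have [->|c0] := eqVneq c 0; first by rewrite scale0r.
by case/negP: vA; rewrite -[v]scale1r -(mulVf c0) -scalerA -wc memvZ.
Qed.

Lemma dim1_line (P : sp) : \dim P = 1%N -> exists2 v, v != 0 & P = <[v]>%VS.
Proof.
move=> dP; exists (vpick P); first by rewrite vpick0 -dimv_eq0 dP.
apply/eqP; rewrite eq_sym eqEdim -memvE memv_pick /= dP dim_vline vpick0 -dimv_eq0 dP.
by [].
Qed.

Lemma neq_points_dim (P Q : sp) : \dim P = 1%N -> \dim Q = 1%N -> P != Q -> \dim (P + Q) = 2%N.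
Proof.
move=> dP dQ PQ; have [v v0 eQ] := dim1_line dQ.
have vP : v \notin P.
  apply: contra PQ => vP; rewrite eq_sym eqEdim {1}eQ -memvE vP dP dQ.
  by [].
by rewrite eQ dim_add_line // dP.
Qed.

(** Every vector of B outside A spans together with A one of the counted spaces T, and T arises from
    exactly q^(dim A + 1) - q^(dim A) vectors. *)
Lemma card_between_succ (A B : sp) : (A <= B)%VS ->
  #|between A B (\dim A).+1|%:R = [\dim B - \dim A]q.
Proof.
move=> AB; set a := \dim A; set b := \dim B.
have ab : (a <= b)%N by exact: dimvS.
have E : (#|between A B a.+1| * (#|F| ^ a.+1 - #|F| ^ a) = #|F| ^ b - #|F| ^ a)%N.
  rewrite -(card_diffv AB) -[RHS]sum1_card -sum_nat_const.
  rewrite [RHS](partition_big (fun v => (A + <[v]>)%VS) (mem (between A B a.+1))) /=; last first.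
    move=> v /andP[vB vA]; rewrite inE addvSl dim_add_line // eqxx andbT /=.
    by rewrite subv_add AB.
  apply: eq_bigr => T; rewrite inE => /and3P[AT TB /eqP dT].
  rewrite -dT -card_diffv // -sum1_card; apply: eq_bigl => v; rewrite inE.
  apply/andP/andP => [[vT vA]|[/andP[vB vA] /eqP <-]].
    split; first by apply/andP; split=> //; apply: (subvP TB).
    by rewrite eqEdim subv_add AT dim_add_line // dT -memvE vT leqnn.
  by rewrite vA memvE addvSr.
have q0 : 0 < q ^+ a by apply: exprn_gt0; exact: lt_trans cardF_gt1.
have q1 : q - 1 != 0 by exact: q1_neq0.
move/(congr1 (fun m => m%:R : R)): E.
rewrite natrM !natrB ?leq_exp2l ?finNzRing_gt1 // !natrX => E.
have qab : q ^+ b = q ^+ a * q ^+ (b - a) by rewrite -exprD subnKC.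
rewrite /qnum; apply: (mulIf q1); rewrite divfK //; apply: (mulIf (lt0r_neq0 q0)).
rewrite exprS qab in E.
transitivity (#|between A B a.+1|%:R * (q * q ^+ a - q ^+ a)); first by ring.
by rewrite E; ring.
Qed.

(** Induction on d - dim A. Double counting the flags A < S <= T with S one dimension above A gives
    the recursion of [gbin_absorb]. *)
Lemma card_between (A B : sp) d : (A <= B)%VS -> (\dim A <= d)%N ->
  #|between A B d|%:R = gbin q (\dim B - \dim A) (d - \dim A).
Proof.
move: {2}(d - \dim A)%N (erefl (d - \dim A)%N) => e; elim: e A => [|e IH] A de AB Ad.
  have -> : d = \dim A by lia.
  rewrite subnn gbin0 -[1]/(1%:R); congr (_%:R); apply: (@eq_card1 _ A) => T.
  rewrite !inE; apply/and3P/eqP => [[AT _ dT]|->]; last by rewrite subvv AB.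
  by apply/eqP; rewrite eq_sym eqEdim AT (eqP dT) leqnn.
rewrite de.
have E : #|between A B d|%:R * [e.+1]q = \sum_(T in between A B (\dim A).+1) #|between T B d|%:R.
  transitivity (\sum_(T in between A B d) \sum_(S in between A T (\dim A).+1) (1 : R)).
    rewrite -sumr_const mulr_suml; apply: eq_bigr => T; rewrite inE => /and3P[AT TB /eqP dT].
    by rewrite mul1r sumr_const card_between_succ // dT de.
  rewrite (exchange_big_dep (mem (between A B (\dim A).+1))) /=; last first.
    move=> T S; rewrite !inE => /and3P[AT TB dT] /and3P[AS ST dS].
    by apply/and3P; split=> //; apply: subv_trans ST TB.
  apply: eq_bigr => S; rewrite inE => /and3P[AS SB dS].
  rewrite sumr_const; congr (_%:R); apply: eq_card => T; rewrite [LHS]unfold_in /= !inE AS dS andbT /=.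
  apply/andP/idP => [[/and3P[_ -> ->] ->] //|/and3P[ST -> ->]].
  by rewrite ST (subv_trans AS ST).
have q0 := qnum_neq0 cardF_gt1 (ltn0Sn e).
apply: (mulIf q0); rewrite E gbin_absorb // -(card_between_succ AB).
rewrite -sumr_const mulr_suml; apply: eq_bigr => S; rewrite inE => /and3P[AS SB /eqP dS].
rewrite IH ?dS //; [|by lia|by lia].
by rewrite mul1r; congr (gbin _ _ _); lia.
Qed.

End SubspaceCounts.

(** * Second moments of a family of subspaces *)

(* Expand [0 <= \sum_b (r1 * w b - G b) ^+ 2], where [G b] sums the deviations
   of [v] from its mean over the points of [b]. *)
Lemma design_variance (R : realFieldType) (I J : finType) (Pt : {set I})
    (B : {set J}) (inc : I -> J -> bool) (r1 r2 : R) (w : J -> R) (v : I -> R) :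
  0 < r1 -> 0 <= r2 ->
  (forall P, P \in Pt -> \sum_(b in B) (inc P b)%:R = r1) ->
  (forall P Q, P \in Pt -> Q \in Pt -> P != Q ->
     \sum_(b in B) (inc P b)%:R * (inc Q b)%:R = r2) ->
  (forall P, P \in Pt -> v P = \sum_(b in B) (inc P b)%:R * w b) ->
  \sum_(P in Pt) v P ^+ 2 - (\sum_(P in Pt) v P) ^+ 2 / #|Pt|%:R
    <= r1 * \sum_(b in B) w b ^+ 2.
Proof.
move=> r1_gt0 r2_ge0 h1 h2 hv.
set S := \sum_(P in Pt) v P; set m := #|Pt|%:R : R.
have rhs0 : 0 <= r1 * \sum_(b in B) w b ^+ 2.
  by rewrite mulr_ge0 ?(ltW r1_gt0) // sumr_ge0 // => b _; exact: sqr_ge0.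
case: (posnP #|Pt|) => [/eqP|] m0.
  rewrite cards_eq0 in m0; move: rhs0; rewrite /S (eqP m0) !big_set0 expr0n mul0r subrr.
  by [].
have m_gt0 : 0 < m by rewrite ltr0n.
pose g P := v P - S / m.
have g_sum : \sum_(P in Pt) g P = 0.
  by rewrite sumrB sumr_const -/S -mulr_natr divfK ?subrr // gt_eqF.
set Var := (X in X <= _).
have VarE : \sum_(P in Pt) g P * v P = Var.
  rewrite /Var -/S expr2 -mulrA mulr_suml -sumrB; apply: eq_bigr => P _.
  by rewrite /g; ring.
have VarE2 : \sum_(P in Pt) g P ^+ 2 = Var.
  rewrite -VarE; apply/eqP; rewrite -subr_eq0 -sumrB; apply/eqP.
  transitivity (- (S / m) * \sum_(P in Pt) g P); last by rewrite g_sum mulr0.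
  by rewrite mulr_sumr; apply: eq_bigr => P _; rewrite /g; ring.
pose G b := \sum_(P in Pt) (inc P b)%:R * g P.
have GE : \sum_(b in B) w b * G b = Var.
  rewrite -VarE.
  under eq_bigr => b _ do rewrite mulr_sumr.
  rewrite exchange_big /=; apply: eq_bigr => P PP.
  by rewrite hv // mulr_sumr; apply: eq_bigr => b _; ring.
(* Off the diagonal the pair count is the constant [r2]. Since [g] sums to 0, the off-diagonal part
   equals minus [r2] times the sum of the squares of [g]. *)
have G2E : \sum_(b in B) G b ^+ 2 = (r1 - r2) * Var.
  transitivity (\sum_(P in Pt) \sum_(Q in Pt) g P * g Q *
      \sum_(b in B) (inc P b)%:R * (inc Q b)%:R).
    under eq_bigr => b _ do rewrite expr2 mulr_suml.
    rewrite exchange_big /=; apply: eq_bigr => P _.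
    under eq_bigr => b _ do rewrite mulr_sumr.
    rewrite exchange_big /=; apply: eq_bigr => Q _.
    by rewrite mulr_sumr; apply: eq_bigr => b _; ring.
  rewrite -VarE2 mulr_sumr; apply: eq_bigr => P PP.
  rewrite (bigD1 P) //=.
  have -> : \sum_(b in B) (inc P b)%:R * (inc P b)%:R = r1.
    by rewrite -(h1 P PP); apply: eq_bigr => b _; case: (inc P b); rewrite ?mulr1 ?mulr0.
  rewrite (eq_bigr (fun Q => g P * g Q * r2)); last first.
    by move=> Q /andP[QP nQ]; rewrite (h2 P Q PP QP) // eq_sym.
  have := g_sum; rewrite (bigD1 P PP) /=.
  rewrite -mulr_suml -mulr_sumr => /eqP; rewrite addrC addr_eq0 => /eqP ->.
  by ring.
have Var_ge0 : 0 <= Var by rewrite -VarE2 sumr_ge0 // => P _; exact: sqr_ge0.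
have : 0 <= \sum_(b in B) (r1 * w b - G b) ^+ 2 by rewrite sumr_ge0 // => b _; exact: sqr_ge0.
have -> : \sum_(b in B) (r1 * w b - G b) ^+ 2 =
    r1 ^+ 2 * (\sum_(b in B) w b ^+ 2) - 2 * r1 * Var + (r1 - r2) * Var.
  rewrite -G2E -GE !mulr_sumr -sumrB -big_split /=; apply: eq_bigr => b _; ring.
(* The expansion is r1 * (r1 * W - Var) - r2 * Var, with W the sum of the squared weights; dropping
   the last term only increases it. *)
move=> h; have h3 := mulr_ge0 r2_ge0 Var_ge0.
rewrite -(ler_pM2l r1_gt0).
move: h; set W := \sum_(b in B) w b ^+ 2 => h.
nra.
Qed.

Lemma card_filter_sum (R : realFieldType) (T : finType) (A : {set T}) (p : pred T) :
  #|[set x in A | p x]|%:R = \sum_(x in A) (p x)%:R :> R.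
Proof.
rewrite -sum1_card natr_sum.
rewrite (eq_bigl (fun x => (x \in A) && p x)); last by move=> x; rewrite inE.
by rewrite big_mkcondr; apply: eq_bigr => x _; case: (p x).
Qed.

Section SecondMoment.
Variables (R : realFieldType) (F : finFieldType) (n : nat).
Local Notation V := 'rV[F]_n.
Local Notation q := (#|F|%:R : R).
Local Notation "[ a ]q" := (qnum q a) (at level 0, a at level 99).
Local Notation sp := {vspace V}.
Let q_gt1 : 1 < q := cardF_gt1 R F.
Hint Resolve q_gt1 : core.
Implicit Types (A : {set sp}) (d k : nat).

Definition dsp d : {set sp} := [set T : sp | \dim T == d].

Lemma in_dsp d T : (T \in dsp d) = (\dim T == d). Proof. by rewrite inE. Qed.

Lemma sum_between (A B : sp) d : (A <= B)%VS -> (\dim A <= d)%N ->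
  \sum_(T in dsp d) ((A <= T)%VS && (T <= B)%VS)%:R
    = gbin q (\dim B - \dim A) (d - \dim A).
Proof.
move=> AB Ad; rewrite -card_between // -sum1_card natr_sum big_mkcond [RHS]big_mkcond /=.
apply: eq_bigr => T _; rewrite !inE.
by case: (A <= T)%VS; case: (T <= B)%VS; case: (\dim T == d).
Qed.

Lemma sum_below (B : sp) d :
  \sum_(T in dsp d) (T <= B)%VS%:R = gbin q (\dim B) d.
Proof.
have := @sum_between 0 B d (sub0v _); rewrite dimv0 => /(_ isT).
by rewrite !subn0 => <-; apply: eq_bigr => T _; rewrite sub0v.
Qed.

Lemma sum_above (A : sp) d : (\dim A <= d)%N ->
  \sum_(T in dsp d) (A <= T)%VS%:R = gbin q (n - \dim A) (d - \dim A).
Proof.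
move=> Ad; have := sum_between (subvf A) Ad; rewrite dim_fullrV => <-.
by apply: eq_bigr => T _; rewrite subvf andbT.
Qed.

Lemma card_dsp d : #|dsp d|%:R = gbin q n d.
Proof.
have := sum_below fullv d; rewrite dim_fullrV => <-; rewrite -sum1_card natr_sum; apply: eq_bigr => T _.
by rewrite subvf.
Qed.

Lemma card_pts : #|dsp 1|%:R = [n]q.
Proof. by rewrite card_dsp gbin1. Qed.

Lemma sum_pts (B : sp) : \sum_(P in dsp 1) (P <= B)%VS%:R = [\dim B]q.
Proof. by rewrite sum_below gbin1. Qed.

Definition deg (A : {set sp}) (W : sp) : R := \sum_(x in A) (W <= x)%VS%:R.

Lemma degE A W : deg A W = #|[set x in A | (W <= x)%VS]|%:R.
Proof. by rewrite card_filter_sum. Qed.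

Lemma sum_deg k A : A \subset dsp k ->
  \sum_(P in dsp 1) deg A P = [k]q * #|A|%:R.
Proof.
move=> /subsetP Ak; rewrite exchange_big /= -[#|A|%:R]sumr_const mulr_sumr.
apply: eq_bigr => x /Ak; rewrite in_dsp => /eqP dx.
by rewrite sum_pts dx mulr1.
Qed.

(** Both sides count triples of two members of [A] and a [d]-space in their intersection. *)
Lemma sum_deg_sqr A d :
  \sum_(P in dsp d) deg A P ^+ 2 = \sum_(x in A) \sum_(z in A) gbin q (\dim (x :&: z)) d.
Proof.
under eq_bigr => P _ do rewrite expr2 /deg mulr_suml.
rewrite exchange_big /=; apply: eq_bigr => x _.
under eq_bigr => P _ do rewrite mulr_sumr.
rewrite exchange_big /=; apply: eq_bigr => z _.
rewrite -sum_below; apply: eq_bigr => P _.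
by rewrite subv_cap; case: (P <= x)%VS; case: (P <= z)%VS; rewrite ?mulr0 ?mulr1.
Qed.

(** Two distinct points span a line, so the count is the same for all pairs, and 0 for d < 2. The
    existential hides this case split from [design_variance]. *)
Lemma pair_count d : exists2 r2 : R, 0 <= r2 &
  forall P Q : sp, P \in dsp 1 -> Q \in dsp 1 -> P != Q ->
    \sum_(T in dsp d) (P <= T)%VS%:R * (Q <= T)%VS%:R = r2.
Proof.
have dPQ (P Q : sp) : P \in dsp 1 -> Q \in dsp 1 -> P != Q -> \dim (P + Q) = 2%N.
  by rewrite !in_dsp => /eqP dP /eqP dQ; exact: neq_points_dim.
have key (P Q : sp) : \sum_(T in dsp d) (P <= T)%VS%:R * (Q <= T)%VS%:R =
    \sum_(T in dsp d) (P + Q <= T)%VS%:R :> R.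
  apply: eq_bigr => T _; rewrite subv_add.
  by case: (P <= T)%VS; case: (Q <= T)%VS; rewrite ?mulr0 ?mulr1.
case: (leqP 2 d) => d2.
  exists (gbin q (n - 2) (d - 2)); first exact: gbin_ge0.
  by move=> P Q hP hQ PQ; rewrite key sum_above dPQ.
exists 0 => // P Q hP hQ PQ; rewrite key big1 // => T; rewrite in_dsp => /eqP dT.
case h : (P + Q <= T)%VS => //.
by have := dimvS h; rewrite dPQ // dT leqNgt d2.
Qed.

(** The variance inequality for points against [k]-spaces, the weight being the indicator of [A]. *)
Lemma var_deg k A : (0 < k <= n)%N -> A \subset dsp k ->
  \sum_(P in dsp 1) deg A P ^+ 2
    <= #|A|%:R * (gbin q n.-1 k.-1 + [k]q ^+ 2 / [n]q * #|A|%:R).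
Proof.
move=> /andP[k0 kn] Ak; have [r2 r20 h2] := pair_count k.
pose w (x : sp) : R := (x \in A)%:R.
have E0 : 0 < gbin q n.-1 k.-1 by rewrite gbin_gt0 //; lia.
have h1 (P : sp) : P \in dsp 1 -> \sum_(b in dsp k) (P <= b)%VS%:R = gbin q n.-1 k.-1.
  by rewrite in_dsp => /eqP dP; rewrite sum_above dP ?subn1.
have sw (f : sp -> R) : \sum_(b in dsp k) f b * w b = \sum_(b in A) f b.
  rewrite [RHS]big_mkcond [LHS]big_mkcond; apply: eq_bigr => x _; rewrite /w.
  case xA : (x \in A); rewrite ?mulr1 ?mulr0; last by case: ifP.
  by rewrite (subsetP Ak _ xA).
have := @design_variance R sp sp (dsp 1) (dsp k) (fun P b => (P <= b)%VS)
  (gbin q n.-1 k.-1) r2 w (deg A) E0 r20 h1 h2.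
move=> /(_ (fun P _ => esym (sw _))).
have -> : \sum_(b in dsp k) w b ^+ 2 = #|A|%:R.
  under eq_bigr => b _ do rewrite expr2.
  rewrite sw -sum1_card natr_sum; apply: eq_bigr => x xA; by rewrite /w xA.
rewrite (sum_deg Ak) card_pts; set X := \sum_(P in _) _.
have n0 : [n]q != 0 by apply: qnum_neq0 => //; lia.
rewrite -subr_ge0 => h; rewrite -subr_ge0; apply: etrans h; congr (0 <= _); field; exact: n0.
Qed.

(** The variance inequality for points against (k-1)-spaces with weight [deg A]: a large variance of
    the point degrees forces many pairs of [A] to share a (k-1)-space. *)
Lemma sum_deg_hyper k A : (1 < k <= n)%N -> A \subset dsp k ->
  [k.-1]q * [n - k.-1]q *
    (\sum_(P in dsp 1) deg A P ^+ 2 - [k]q ^+ 2 / [n]q * #|A|%:R ^+ 2)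
  <= gbin q n.-1 k.-1 * \sum_(U in dsp k.-1) deg A U ^+ 2.
Proof.
move=> /andP[k1 kn] Ak; have [r2 r20 h2] := pair_count k.-1.
have r10 : 0 < gbin q n.-1 k.-2 by rewrite gbin_gt0 //; lia.
have h1 (P : sp) : P \in dsp 1 -> \sum_(b in dsp k.-1) (P <= b)%VS%:R = gbin q n.-1 k.-2.
  by rewrite in_dsp => /eqP dP; rewrite sum_above dP ?subn1 //; lia.
(* A [k]-space through P has [[k.-1]q] hyperplanes through P, so each member above P is counted that
   often. *)
have hv (P : sp) : P \in dsp 1 ->
   [k.-1]q * deg A P = \sum_(U in dsp k.-1) (P <= U)%VS%:R * deg A U.
  rewrite in_dsp => /eqP dP.
  under eq_bigr => U _ do rewrite /deg mulr_sumr.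
  rewrite exchange_big /= mulr_sumr; apply: eq_bigr => x /(subsetP Ak).
  rewrite in_dsp => /eqP dx; case Px : (P <= x)%VS; last first.
    rewrite mulr0 big1 // => U _; case h : (P <= U)%VS; rewrite ?mul0r //.
    case h' : (U <= x)%VS; rewrite ?mulr0 //.
    by move: Px; rewrite (subv_trans h h').
  have Pk : (\dim P <= k.-1)%N by rewrite dP; lia.
  have := sum_between Px Pk; rewrite dx dP.
  have -> : (k - 1 = k.-2.+1)%N by lia.
  have -> : (k.-1 - 1 = k.-2)%N by lia.
  rewrite gbin_pred // mulr1.
  have -> : k.-2.+1 = k.-1 by lia.
  move=> <-; apply: eq_bigr => U _.
  by case: (P <= U)%VS; case: (U <= x)%VS; rewrite ?mulr0 ?mulr1.
have := @design_variance R sp sp (dsp 1) (dsp k.-1) (fun P b => (P <= b)%VS)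
  (gbin q n.-1 k.-2) r2 (deg A) (fun P => [k.-1]q * deg A P) r10 r20 h1 h2 hv.
under eq_bigr => P _ do rewrite exprMn.
rewrite -mulr_sumr -mulr_sumr (sum_deg Ak) card_pts.
set X := \sum_(P in _) _; set Y := \sum_(U in _) _.
have n0 : [n]q != 0 by apply: qnum_neq0 => //; lia.
have E : gbin q n.-1 k.-1 * [k.-1]q = gbin q n.-1 k.-2 * [n - k.-1]q.
  have -> : k.-1 = k.-2.+1 by lia.
  by rewrite gbin_next //; [congr (_ * qnum _ _); lia | lia].
have k0 : 0 < [k.-1]q by apply: qnum_gt0 => //; lia.
have b0 : 0 <= [n - k.-1]q by apply: qnum_ge0.
move=> h; rewrite -(ler_pM2l k0).
have -> : [k.-1]q * (gbin q n.-1 k.-1 * Y) = [n - k.-1]q * (gbin q n.-1 k.-2 * Y).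
  by rewrite mulrA [_ * gbin _ _ _]mulrC E; ring.
have := ler_wpM2l b0 h.
rewrite -subr_ge0 => h2'; rewrite -subr_ge0; apply: etrans h2'; congr (0 <= _); field; exact: n0.
Qed.

End SecondMoment.

(** * Codimension-one neighbours *)

Lemma pred_id_neq k : k = k.-1 -> (0 < k)%N -> False.
Proof. by lia. Qed.

Section Pencils.
Variables (R : realFieldType) (F : finFieldType) (n : nat).
Local Notation V := 'rV[F]_n.
Local Notation q := (#|F|%:R : R).
Local Notation "[ a ]q" := (qnum q a) (at level 0, a at level 99).
Local Notation sp := {vspace V}.
Let q_gt1 : 1 < q := cardF_gt1 R F.
Hint Resolve q_gt1 : core.
Implicit Types (A : {set sp}) (d k : nat) (x y z P H U : sp).

Local Notation dsp := (@dsp F n).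

(** Neighbours of [x] in the Grassmann graph, restricted to the interval from [L] to [H]. *)
Definition nbr k x (L H : sp) : {set sp} :=
  [set y in dsp k | [&& (L <= y)%VS, (y <= H)%VS & \dim (x :&: y) == k.-1]].

(** There are [[k - \dim L]q] choices for U = x :&: y. The [k]-spaces between U and [H] number 1 + q
    * [dim H - k], and the 1 is [x] itself. *)
Lemma card_nbr k x L H : (0 < k)%N -> \dim x = k -> (L <= x)%VS -> (x <= H)%VS ->
  #|nbr k x L H|%:R <= [k - \dim L]q * (q * [\dim H - k]q).
Proof.
move=> k0 dx Lx xH; have Lk : (\dim L <= k)%N by rewrite -dx dimvS.
have kH : (k <= \dim H)%N by rewrite -dx dimvS.
have rhs0 : 0 <= [k - \dim L]q * (q * [\dim H - k]q).
  by apply: mulr_ge0; rewrite ?qnum_ge0 // mulr_ge0 ?ler0n ?qnum_ge0.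
case: (ltnP (\dim L) k) => Lk1; last first.
  suff -> : nbr k x L H = set0 by rewrite cards0.
  apply/setP => y; rewrite !inE; apply/negP => /and4P[/eqP dy Ly yH /eqP dxy].
  have eL : L = x by apply/eqP; rewrite eqEdim Lx dx.
  by move: dxy; rewrite (capv_idPl _) -?eL // eL dx; lia.
have -> : #|nbr k x L H|%:R =
   \sum_(U in between L x k.-1) #|[set y in nbr k x L H | (x :&: y)%VS == U]|%:R :> R.
  rewrite -natr_sum; congr (_%:R); rewrite -sum1_card.
  rewrite (partition_big (fun y => (x :&: y)%VS) (mem (between L x k.-1))) /=; last first.
    move=> y; rewrite !inE => /and4P[/eqP dy Ly yH ->].
    by rewrite subv_cap Lx Ly capvSl.
  by apply: eq_bigr => U _; rewrite sum1dep_card; apply: eq_card => y; rewrite !inE.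
have cU : #|between L x k.-1|%:R = [k - \dim L]q.
  rewrite card_between ?dx //; last by lia.
  have -> : (k - \dim L = (k.-1 - \dim L).+1)%N by lia.
  by rewrite gbin_pred.
rewrite -cU mulr_natl -[_ *+ #|_|]sumr_const; apply: ler_sum => U.
rewrite inE => /and3P[LU Ux /eqP dU].
have UH : (U <= H)%VS by exact: subv_trans xH.
have xb : x \in between U H k by rewrite inE Ux xH dx eqxx.
have : #|between U H k|%:R = 1 + q * [\dim H - k]q.
  rewrite card_between // dU ?leq_pred //.
  have -> : (k - k.-1 = 1)%N by clear -k0; lia.
  rewrite gbin1 //; have -> : (\dim H - k.-1 = (\dim H - k).+1)%N by clear -k0 kH; lia.
  by rewrite qnumS // addrC.
rewrite (cardsD1 x) xb natrD => /addrI <-.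
rewrite ler_nat subset_leq_card //; apply/subsetP => y; rewrite !inE.
move=> /andP[/and4P[/eqP dy Ly yH /eqP dxy] /eqP xyU].
rewrite -xyU capvSr yH dy eqxx !andbT; apply/eqP => yx.
by move: dxy; rewrite yx capvv dx => e; exact: pred_id_neq e k0.
Qed.

Lemma ler_card_nbr k x L H b : (0 < k)%N -> \dim x = k -> (L <= x)%VS -> (x <= H)%VS ->
  (\dim H <= b)%N -> #|nbr k x L H|%:R <= [k - \dim L]q * (q * [b - k]q).
Proof.
move=> k0 dx Lx xH Hb; apply: le_trans (card_nbr k0 dx Lx xH) _.
apply: ler_wpM2l; first exact: qnum_ge0.
rewrite ler_pM2l ?ler_qnum ?leq_sub2r //; exact: lt_trans ltr01 q_gt1.
Qed.

(** The summand is [[k]q] at y = x, 1 at the codimension-one neighbours of [x], and 0 elsewhere. *)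
Lemma sum_gbin_hyper k A x : (0 < k)%N -> A \subset dsp k -> x \in A ->
  \sum_(y in A) gbin q (\dim (x :&: y)) k.-1
    = [k]q + #|[set y in A | \dim (x :&: y) == k.-1]|%:R.
Proof.
move=> k0 Ak xA; have dA y : y \in A -> \dim y = k.
  by move=> /(subsetP Ak); rewrite in_dsp => /eqP.
rewrite (bigD1 x xA) /= capvv dA //; congr (_ + _).
  by rewrite -(prednK k0) gbin_pred.
rewrite card_filter_sum [RHS](bigD1 x xA) /= capvv dA //.
have -> : (k == k.-1) = false by apply/eqP => e; case: (pred_id_neq e k0).
rewrite add0r; apply: eq_bigr => y /andP[yA yx].
have dxy : (\dim (x :&: y) <= k)%N by rewrite -(dA x xA) dimvS ?capvSl.
have dxy1 : (\dim (x :&: y) < k)%N.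
  rewrite ltn_neqAle dxy andbT; apply: contra yx => /eqP e.
  have /eqP e1 : (x :&: y == y)%VS by rewrite eqEdim capvSr e (dA y yA) /=.
  have /eqP e2 : (x :&: y == x)%VS by rewrite eqEdim capvSl e (dA x xA) /=.
  by rewrite -e1 e2.
case: eqP => [->|ne]; first by rewrite gbinn.
by rewrite gbin_small //; clear -dxy1 ne k0; lia.
Qed.

Definition intersecting A := forall x y, x \in A -> y \in A -> (x :&: y)%VS != 0%VS.

(** Each pair contributes the number of its common points: at least 1, and at least q + 1 once the
    intersection contains a line. *)
Lemma sum_deg_sqr_intersecting A : intersecting A ->
  #|A|%:R ^+ 2 + q * \sum_(x in A) #|[set z in A | (2 <= \dim (x :&: z))%N]|%:R
    <= \sum_(P in dsp 1) deg R A P ^+ 2.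
Proof.
move=> intA; rewrite sum_deg_sqr expr2 -[X in X * _ + _]sumr_const mulr_suml.
rewrite mulr_sumr -big_split /=; apply: ler_sum => x xA.
rewrite mul1r card_filter_sum mulr_sumr -[N in N + _]sumr_const -big_split /=.
apply: ler_sum => z zA.
rewrite gbin1 //; have d0 : (0 < \dim (x :&: z))%N by rewrite lt0n dimv_eq0 intA.
case: leqP => [_|d2]; rewrite ?mulr1 ?mulr0.
  by rewrite addr0; apply: le_trans (ler_qnum q_gt1 d0); rewrite qnum1.
apply: le_trans (ler_qnum q_gt1 d2).
by rewrite qnumS // qnum1 // mulr1 addrC.
Qed.

(** Let S be the sum of the squared point degrees. The upper bound on S from [var_deg] makes pairs
    meeting in more than a point rare; the lower bound N^2 <= S, fed into [sum_deg_hyper], makes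
    codimension-one pairs frequent. A weighted average finds one [x] good for both. *)
Lemma exists_rich_member k A (E kap M0 : R) :
  (1 < k)%N -> (2 * k <= n)%N -> A \subset dsp k -> intersecting A ->
  E = gbin q n.-1 k.-1 -> M0 = [k.-1]q * [n - k.-1]q -> kap = [k]q ^+ 2 / [n]q ->
  kap <= 30^-1 -> 8 / 9 * E <= #|A|%:R ->
  exists2 x, x \in A &
    61 / 100 * M0 <= [k]q + #|[set y in A | \dim (x :&: y) == k.-1]|%:R /\
    #|[set z in A | (2 <= \dim (x :&: z))%N]|%:R <= 4 / 5 * #|A|%:R :> R.
Proof.
move=> k1 kn Ak intA eE eM ek kap_le cA.
have q2 : 2 <= q by rewrite ler_nat finNzRing_gt1.
have nk1 : (n - k.-1 = (n - k).+1)%N by clear -k1 kn; lia.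
have k0 : (0 < k)%N by clear -k1; lia.
have kn' : (0 < k <= n)%N by clear -k1 kn; lia.
have kn'' : (1 < k <= n)%N by clear -k1 kn; lia.
have kk : k = k.-2.+2 by clear -k1; lia.
have E0 : 0 < E by rewrite eE gbin_gt0 //; clear -k1 kn; lia.
have M00 : 0 < M0 by rewrite eM mulr_gt0 ?qnum_gt0 //; clear -k1 kn; lia.
have kap0 : 0 <= kap by rewrite ek divr_ge0 ?sqr_ge0 // qnum_ge0.
set N := #|A|%:R : R in cA *.
have N0 : 0 < N by apply: lt_le_trans cA; lra.
pose a x := [k]q + #|[set y in A | \dim (x :&: y) == k.-1]|%:R : R.
pose D x := #|[set z in A | (2 <= \dim (x :&: z))%N]|%:R : R.
set S := \sum_(P in dsp 1) deg R A P ^+ 2.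
have h1 : N ^+ 2 + q * \sum_(x in A) D x <= S by exact: sum_deg_sqr_intersecting.
have h2 : S <= N * (E + kap * N).
  by rewrite eE ek; exact: var_deg.
have h3 : M0 * (S - kap * N ^+ 2) <= E * \sum_(x in A) a x.
  have -> : \sum_(x in A) a x = \sum_(U in dsp k.-1) deg R A U ^+ 2.
    by rewrite sum_deg_sqr; apply: eq_bigr => x xA; rewrite sum_gbin_hyper.
  by rewrite eE ek eM; exact: sum_deg_hyper.
have aub x : x \in A -> a x <= (q + 1) * M0.
  move=> xA; have dx : \dim x = k by move: (subsetP Ak _ xA); rewrite in_dsp => /eqP.
  have : #|[set y in A | \dim (x :&: y) == k.-1]|%:R <= [k]q * (q * [n - k]q) :> R.
    have := card_nbr k0 dx (sub0v x) (subvf x); rewrite dimv0 subn0 dim_fullrV.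
    apply: le_trans; rewrite ler_nat subset_leq_card //; apply/subsetP => y.
    by rewrite !inE sub0v subvf => /andP[/(subsetP Ak)]; rewrite in_dsp => -> ->.
  move=> h; apply: le_trans (_ : [k]q * [n - k.-1]q <= _).
    by rewrite nk1 qnumS // /a; lra.
  rewrite eM mulrA ler_wpM2r ?qnum_ge0 //.
  have u1 : 1 <= [k.-1]q.
    have -> : k.-1 = k.-2.+1 by rewrite {1}kk.
    exact: le_trans (qX_ge1 q_gt1 _) (qnum_ge_expr q_gt1 _).
  have -> : [k]q = q * [k.-1]q + 1 by rewrite -{1}(prednK k0) qnumS.
  by clear -u1; lra.
set SD := \sum_(x in A) D x in h1; set Sa := \sum_(x in A) a x in h3.
(* E + kap * N is at most (9/8 + 1/30) * N, and 1/8 + 1/30 = 19/120. *)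
have SD_ub : q * SD <= N * N * (19 / 120).
  have t1 : E <= 9 / 8 * N by lra.
  have t2 : kap * N <= 30^-1 * N by rewrite ler_pM2r.
  have t3 : N * (E + kap * N) <= N * (9 / 8 * N + 30^-1 * N) by rewrite ler_pM2l //; lra.
  by move: h1 h2 t3; rewrite expr2; clear; lra.
(* 116/135 is 29/30 times 8/9. Subtracting 3/2 * 19/120 from it still leaves more than 61/100. *)
have Sa_lb : 116 / 135 * (M0 * N) <= Sa.
  rewrite -(ler_pM2l E0).
  have SDq : 0 <= q * SD.
    by rewrite mulr_ge0 ?sumr_ge0 // => [|x _]; rewrite ?ler0n.
  have t1 : kap * N ^+ 2 <= 30^-1 * N ^+ 2 by rewrite ler_wpM2r ?sqr_ge0.
  have t2 : M0 * (29 / 30 * N ^+ 2) <= M0 * (S - kap * N ^+ 2).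
    by rewrite ler_pM2l //; lra.
  have t3 : M0 * (29 / 30 * (N * (8 / 9 * E))) <= M0 * (29 / 30 * N ^+ 2).
    by rewrite ler_pM2l // ler_pM2l ?expr2 ?ler_pM2l //; lra.
  apply: le_trans h3; apply: le_trans t2; apply: le_trans t3.
  by rewrite le_eqVlt; apply/orP; left; apply/eqP; field.
(* The weight 3/2 q is large enough for [a x <= (q + 1) * M0] to force
   [D x <= 4/5 * N]. *)
have [x xA hx] : exists2 x, x \in A & 61 / 100 * M0 * N + 3 / 2 * q * M0 * D x <= a x * N.
  apply/exists_inP; apply: contraT; rewrite negb_exists_in => /forall_inP hno.
  have : \sum_(x in A) a x * N <= \sum_(x in A) (61 / 100 * M0 * N + 3 / 2 * q * M0 * D x).
    by apply: ler_sum => x /hno; rewrite -ltNge => /ltW.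
  rewrite -mulr_suml -/Sa big_split /= sumr_const -[_ *+ #|A|]mulr_natr -/N -mulr_sumr -/SD.
  have p1 : 116 / 135 * (M0 * N) * N <= Sa * N by rewrite ler_pM2r.
  have p2 : M0 * (q * SD) <= M0 * (N * N * (19 / 120)) by rewrite ler_pM2l.
  have p3 : 0 < M0 * N * N by rewrite !mulr_gt0.
  by move=> p4; clear -p1 p2 p3 p4; lra.
exists x => //; split.
  rewrite -/(a x) -(ler_pM2r N0); apply: le_trans hx.
  rewrite lerDl; apply: mulr_ge0; last exact: ler0n.
  by apply: mulr_ge0; [clear -q2; lra | exact: ltW].
rewrite -/(D x) -/N.
(* What remains is that (q + 39/100) / (3/2 * q) is at most 4/5, which holds from q = 2 on. *)
have p1 : a x * N <= (q + 1) * M0 * N by rewrite ler_pM2r // aub.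
have p2 : M0 * (61 / 100 * N + 3 / 2 * q * D x) <= M0 * ((q + 1) * N) by clear -hx p1; lra.
rewrite ler_pM2l // in p2.
have q0 : 0 < q by exact: lt_trans q_gt1.
rewrite -(ler_pM2l q0).
have p3 : 2 * N <= q * N by rewrite ler_pM2r.
clear -p2 p3 N0; lra.
Qed.

End Pencils.

(** * Large intersecting families and pencils *)

Section Stability.
Variables (R : realFieldType) (F : finFieldType) (n : nat).
Local Notation V := 'rV[F]_n.
Local Notation q := (#|F|%:R : R).
Local Notation "[ a ]q" := (qnum q a) (at level 0, a at level 99).
Local Notation sp := {vspace V}.
Let q_gt1 : 1 < q := cardF_gt1 R F.
Hint Resolve q_gt1 : core.
Implicit Types (A : {set sp}) (d k : nat) (x y z P H U : sp).

Local Notation dsp := (@dsp F n).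

Definition star k P : {set sp} := [set y in dsp k | (P <= y)%VS].
Definition costar k H : {set sp} := [set y in dsp k | (y <= H)%VS].

Variant is_pencil k : {set sp} -> Prop :=
| StarPencil P of \dim P = 1%N : is_pencil k (star k P)
| CostarPencil H of n = (2 * k)%N & \dim H = n.-1 : is_pencil k (costar k H).

(** Take a nonzero w in y :&: z. If w lies in [x], it spans the point x :&: z. Otherwise x + <[w]>
    has dimension k + 1 and fills x + y, so [y] lies in x + z. *)
Lemma neighbor_dichotomy k x y z :
  (0 < k)%N -> \dim x = k -> \dim y = k -> \dim (x :&: z) = 1%N -> \dim (x :&: y) = k.-1 ->
  (y :&: z)%VS != 0%VS -> (x :&: z <= y)%VS || (y <= x + z)%VS.
Proof.
move=> k0 dx dy dxz dxy yz.
pose w := vpick (y :&: z); have w0 : w != 0 by rewrite vpick0.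
have : w \in (y :&: z)%VS by exact: memv_pick.
rewrite memv_cap => /andP[wy wz].
case wx : (w \in x).
  have -> : (x :&: z = <[w]>)%VS; last by rewrite -memvE wy.
  apply/eqP; rewrite eq_sym eqEdim -memvE memv_cap wx wz /= dxz dim_vline w0.
  by [].
apply/orP; right.
have sxy : (x + <[w]> <= x + y)%VS by rewrite addvS // -memvE.
have e : (x + <[w]> == x + y)%VS.
  rewrite eqEdim sxy dim_add_line ?wx //; have := dimv_sum_cap x y.
  by rewrite dx dy dxy; clear -k0; lia.
apply: subv_trans (addvSr x y) _; rewrite -(eqP e).
by rewrite addvS // -memvE.
Qed.

(** Around a rich member [x], let [Z] be the members meeting it in a point and [N] its neighbours in
    [A]. If [Z] were in no single pencil, the dichotomy would confine [N] to a few intervals, and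
    the [card_nbr] bounds would contradict the last two numerical hypotheses. *)
Lemma intersecting_pencil k A (E kap M0 : R) :
  (1 < k)%N -> (2 * k <= n)%N -> A \subset dsp k -> intersecting A ->
  E = gbin q n.-1 k.-1 -> M0 = [k.-1]q * [n - k.-1]q -> kap = [k]q ^+ 2 / [n]q ->
  kap <= 30^-1 -> 8 / 9 * E <= #|A|%:R ->
  [k]q <= 1 / 100 * M0 ->
  ((2 * k < n)%N -> [k - 2]q * (q * [n - k]q) + 2 * ([k]q * (q * [k.-1]q)) < 6 / 10 * M0) ->
  (n = (2 * k)%N -> [k - 2]q * (q * [k]q) + 2 * ([k.-1]q * (q * [k.-1]q)) +
      [k]q * (q * [k - 2]q) < 6 / 10 * M0) ->
  exists2 Pi, is_pencil k Pi & 8 / 45 * E <= #|A :&: Pi|%:R.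
Proof.
move=> k1 kn Ak intA eE eM ek kap_le cA t1 t2 t3.
have k0 : (0 < k)%N by exact: ltnW.
have dA (y : sp) : y \in A -> \dim y = k.
  by move=> /(subsetP Ak); rewrite in_dsp => /eqP.
have E0 : 0 < E by rewrite eE gbin_gt0 //; clear -k1 kn; lia.
have [x xA [hN hD]] := exists_rich_member k1 kn Ak intA eE eM ek kap_le cA.
pose Z := [set z in A | \dim (x :&: z) == 1%N].
have dx := dA x xA.
(* At least a fifth of [A] remains, and 1/5 * 8/9 = 8/45. *)
have cZ : 8 / 45 * E <= #|Z|%:R.
  have : #|Z|%:R + #|[set z in A | (2 <= \dim (x :&: z))%N]|%:R = #|A|%:R :> R.
    rewrite !card_filter_sum -big_split /= -sumr_const; apply: eq_bigr => z zA.
    have : (0 < \dim (x :&: z))%N by rewrite lt0n dimv_eq0 intA.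
    by case: (\dim _) => [|[|m]] //= _; rewrite ?addr0 ?add0r.
  by clear -cA hD; lra.
have subZ (Pi : {set sp}) : {subset Z <= Pi} -> 8 / 45 * E <= #|A :&: Pi|%:R.
  move=> h; apply: le_trans cZ _; rewrite ler_nat subset_leq_card //; apply/subsetP => z zZ.
  by rewrite inE h // andbT; move: zZ; rewrite inE => /andP[].
have dPz (z : sp) : z \in Z -> \dim (x :&: z) = 1%N by rewrite inE => /andP[_ /eqP].
have ZA (z : sp) : z \in Z -> z \in A by rewrite inE => /andP[].
have dHz (z : sp) : z \in Z -> \dim (x + z) = (2 * k).-1.
  move=> zZ; have := dimv_sum_cap x z; rewrite dPz // dx (dA z (ZA _ zZ)).
  by clear -k0; move: (\dim _) => m; lia.
set N := [set y in A | \dim (x :&: y) == k.-1] in hN.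
have hN' : 6 / 10 * M0 <= #|N|%:R by clear -hN t1; lra.
have dich (y z : sp) : y \in N -> z \in Z -> (x :&: z <= y)%VS || (y <= x + z)%VS.
  rewrite inE => /andP[yA /eqP dxy] zZ.
  exact: neighbor_dichotomy k0 dx (dA y yA) (dPz z zZ) dxy (intA _ _ yA (ZA z zZ)).
have Nnbr (y L H : sp) : y \in N -> (L <= y)%VS -> (y <= H)%VS -> y \in nbr k x L H.
  by rewrite !inE => /andP[yA ->] -> ->; rewrite dA // eqxx.
have cov2 (S1 S2 : {set sp}) : (#|S1 :|: S2|%:R <= #|S1|%:R + #|S2|%:R :> R).
  by rewrite -natrD ler_nat cardsU leq_subr.
have [z0 z0Z] : exists z0, z0 \in Z.
  apply/existsP; apply: contraT; rewrite negb_exists => /forallP h.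
  have Z0 : #|Z| = 0%N by apply: eq_card0 => z; exact/negbTE/h.
  by move: cZ; rewrite Z0; clear -E0; lra.
case: (boolP [forall z in Z, (x :&: z)%VS == (x :&: z0)%VS]) => [/forall_inP hP|].
  exists (star k (x :&: z0)); first by apply: StarPencil; exact: dPz.
  apply: subZ => z zZ; rewrite !inE dA ?ZA // eqxx /= -(eqP (hP z zZ)).
  exact: capvSr.
rewrite negb_forall_in => /exists_inP[z1 z1Z neP].
have dL : \dim ((x :&: z1) + (x :&: z0)) = 2%N by apply: neq_points_dim; rewrite ?dPz.
have Lx : ((x :&: z1) + (x :&: z0) <= x)%VS by rewrite subv_add !capvSl.
have kb : ((2 * k).-1 - k = k.-1)%N by clear -k0; lia.
have := kn; rewrite leq_eqVlt => /orP[/eqP n2k|n2k]; last first.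
  (* A neighbour in neither x + z0 nor x + z1 contains both points, hence the line they span. *)
  have : N \subset nbr k x ((x :&: z1) + (x :&: z0)) fullv :|:
       (nbr k x 0 (x + z0) :|: nbr k x 0 (x + z1)).
    apply/subsetP => y yN; rewrite !in_setU.
    case: (boolP (y <= x + z0)%VS) => [h|n0]; first by rewrite [y \in nbr _ _ _ (x + z0)]Nnbr ?sub0v // orbT.
    case: (boolP (y <= x + z1)%VS) => [h|n1]; first by rewrite [y \in nbr _ _ _ (x + z1)]Nnbr ?sub0v // !orbT.
    rewrite Nnbr ?subvf // subv_add.
    by move: (dich y z0 yN z0Z) (dich y z1 yN z1Z); rewrite (negPf n0) (negPf n1) !orbF => -> ->.
  move/subset_leq_card; rewrite -(ler_nat R) => h.
  have c1 := card_nbr R k0 dx Lx (subvf x).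
  have c2 := card_nbr R k0 dx (sub0v x) (addvSl x z0).
  have c3 := card_nbr R k0 dx (sub0v x) (addvSl x z1).
  rewrite dL dim_fullrV in c1; rewrite dimv0 subn0 dHz // kb in c2.
  rewrite dimv0 subn0 dHz // kb in c3.
  have := t2 n2k; have := le_trans h (cov2 _ _).
  have := cov2 (nbr k x 0 (x + z0)) (nbr k x 0 (x + z1)).
  by clear -c1 c2 c3 hN'; lra.
(* For n = 2k each x + z is a hyperplane. If both the points and the hyperplanes differed, the four
   combinations of the dichotomy would leave too few neighbours. *)
have h01 (z z' : sp) : z \in Z -> z' \in Z -> (x :&: z != x :&: z')%VS -> (x + z == x + z')%VS.
  move=> zZ z'Z neP'; apply: contraT => neH; exfalso.
  have dL' : \dim ((x :&: z) + (x :&: z')) = 2%N by apply: neq_points_dim; rewrite ?dPz.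
  have Lx' : ((x :&: z) + (x :&: z') <= x)%VS by rewrite subv_add !capvSl.
  have xH : (x <= (x + z) :&: (x + z'))%VS by rewrite subv_cap !addvSl.
  have dH : (\dim ((x + z) :&: (x + z')) <= (2 * k).-2)%N.
    have c := dimvS (capvSl (x + z) (x + z')).
    have e : \dim ((x + z) :&: (x + z')) != (2 * k).-1.
      apply: contra neH => /eqP e.
      have /eqP e1 : ((x + z) :&: (x + z') == x + z)%VS by rewrite eqEdim capvSl dHz ?e /=.
      have /eqP e2 : ((x + z) :&: (x + z') == x + z')%VS by rewrite eqEdim capvSr dHz ?e /=.
      by rewrite -e1 e2.
    rewrite dHz // in c; clear -c e; move: (\dim _) c e => m; lia.
  have : N \subset (nbr k x ((x :&: z) + (x :&: z')) fullv :|: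
       nbr k x (x :&: z) (x + z')) :|: (nbr k x (x :&: z') (x + z) :|:
       nbr k x 0 ((x + z) :&: (x + z'))).
    apply/subsetP => y yN; rewrite !in_setU.
    case/orP: (dich y z yN zZ) => [p|p]; case/orP: (dich y z' yN z'Z) => [p'|p'].
    - by rewrite Nnbr ?subvf // subv_add p p'.
    - by rewrite [y \in nbr _ _ (x :&: z) (x + z')]Nnbr // orbT.
    - by rewrite [y \in nbr _ _ (x :&: z') (x + z)]Nnbr // !orbT.
    - by rewrite [y \in nbr _ _ 0 _]Nnbr ?sub0v ?subv_cap ?p ?p' // !orbT.
  move/subset_leq_card; rewrite -(ler_nat R) => h.
  have c1 := card_nbr R k0 dx Lx' (subvf x).
  have c2 := card_nbr R k0 dx (capvSl x z) (addvSl x z').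
  have c3 := card_nbr R k0 dx (capvSl x z') (addvSl x z).
  have c4 := ler_card_nbr R k0 dx (sub0v x) xH dH.
  rewrite dL' dim_fullrV (_ : (n - k)%N = k) in c1; last by clear -n2k; lia.
  rewrite dPz // subn1 dHz // kb in c2; rewrite dPz // subn1 dHz // kb in c3.
  rewrite dimv0 subn0 (_ : ((2 * k).-2 - k)%N = (k - 2)%N) in c4; last by clear; lia.
  have := t3 (esym n2k); have := le_trans h (cov2 _ _).
  have := cov2 (nbr k x ((x :&: z) + (x :&: z')) fullv) (nbr k x (x :&: z) (x + z')).
  have := cov2 (nbr k x (x :&: z') (x + z)) (nbr k x 0 ((x + z) :&: (x + z'))).
  by clear -c1 c2 c3 c4 hN'; lra.
have h10 := h01 z1 z0 z1Z z0Z neP.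
exists (costar k (x + z0)); first by apply: CostarPencil => //; rewrite dHz // n2k.
apply: subZ => z zZ; rewrite !inE dA ?ZA // eqxx /=.
suff /eqP <- : (x + z == x + z0)%VS by exact: addvSr.
(* A [z] sharing the point of [z0] differs in its point from [z1], so the hyperplane of [z1],
   already known to be that of [z0], is also that of [z]. *)
case: (eqVneq (x :&: z)%VS (x :&: z0)%VS) => [e|ne]; last exact: h01.
rewrite -(eqP h10); apply: h01 => //; by rewrite e eq_sym.
Qed.

End Stability.

(** * Partial spreads *)

(** The splitting field of X^m - X for m = q^e. The polynomial is separable and its roots exhaust
    the field, so the field has m elements and degree [e]. *)
Lemma exists_field_ext (F : finFieldType) (e : nat) : (0 < e)%N ->
  exists L : fieldExtType F, \dim {:L} = e.
Proof.
move=> e0; have F1 : (1 < #|F|)%N by exact: finNzRing_gt1.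
pose m := (#|F| ^ e)%N; have m1 : (1 < m)%N by rewrite (ltn_exp2l 0).
pose P (K : nzRingType) : {poly K} := 'X^m - 'X.
have sP (K : nzRingType) : size (P K) = m.+1.
  by rewrite size_polyDl size_polyXn // size_polyN size_polyX.
have nzP : P F != 0 by rewrite -size_poly_eq0 sP.
have [L splitL] := FinSplittingFieldFor nzP; pose Fm := FinFieldExtType L; exists L.
rewrite rmorphB rmorphXn /= map_polyX -/(P L) in splitL; have [zs PL defL] := splitL.
have in_zs z : (z \in zs) = (z ^+ m == z).
  by rewrite -root_prod_XsubC -(eqp_root PL) /root !hornerE subr_eq0.
have Uzs : uniq zs.
  have m0 : m%:R = 0 :> L.
    have [p p_pr pF] := finPcharP F.
    have pL : p \in [pchar L] by rewrite pchar_lalg.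
    have : (p %| #|F|)%N.
      have : (1 < p ^ logn p #|F|)%N by rewrite -(card_pprimeChar pF).
      rewrite {2}(card_pprimeChar pF); case: (logn _ _) => // j _.
      by rewrite expnS dvdn_mulr.
    move=> pF'; apply/eqP; rewrite -(dvdn_pcharf pL); apply: dvdn_trans pF' _.
    by rewrite /m -(prednK e0) expnS dvdn_mulr.
  rewrite -separable_prod_XsubC -(eqp_separable PL) unlock derivB derivXn derivX.
  by rewrite -scaler_nat m0 scale0r sub0r -scaleN1r coprimepZr ?oppr_eq0 ?oner_eq0 // coprimep1.
(* The roots of X^m - X are the fixed points of a power of the Frobenius
   automorphism, hence form a subfield. *)
have [a _ aE] := finField_galois_generator (sub1v {:L}%AS).
have aX j z : (a ^+ j)%g z = z ^+ (#|F| ^ j).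
  elim: j z => [|j IH] z; first by rewrite gal_id.
  by rewrite expgSr galM ?memvf // IH aE ?memvf // dimv1 expn1 -exprM -expnSr.
have all_root (z : L) : z ^+ m = z.
  have sub : (<<1 & zs>> <= fixedSpace (a ^+ e)%g)%VS.
    rewrite -[X in (_ <= X)%VS]subfield_closed agenvS // subv_add sub1v.
    by apply/span_subvP => y; rewrite in_zs /m -aX => /eqP ya; apply/fixedSpaceP.
  by rewrite /m -aX; apply/fixedSpaceP; apply: (subvP sub); rewrite defL memvf.
have cL : #|Fm| = m.
  have /eq_card -> : Fm =i zs by move=> z; rewrite in_zs all_root eqxx.
  rewrite (card_uniqP _) //; apply: succn_inj.
  by rewrite -(size_prod_XsubC _ id) -(eqp_size PL) sP.
have cL' : #|Fm| = (#|F| ^ \dim {:L})%N.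
  by rewrite -(@card_vspace F Fm _ (fullv : {vspace L})); apply: eq_card => v; rewrite memvf.
by apply/eqP; rewrite -(eqn_exp2l _ _ F1) -cL' cL.
Qed.

Lemma exists_embedding (F : fieldType) (vT1 vT2 : vectType F) :
  (\dim {:vT1} <= \dim {:vT2})%N -> exists f : 'Hom(vT1, vT2), lker f == 0%VS.
Proof.
move=> d12; pose X := vbasis {:vT1}; pose Y := take (\dim {:vT1}) (vbasis {:vT2}).
have sY : size Y = \dim {:vT1} by rewrite size_takel // size_tuple.
have freeY : free Y.
  have := basis_free (vbasisP {:vT2}).
  by rewrite -{1}(cat_take_drop (\dim {:vT1}) (vbasis {:vT2})) => /catl_free.
have sXY : size Y = size X by rewrite sY size_tuple.
have [f /(_ (basis_free (vbasisP _)) sXY) fX] := linear_of_free X Y.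
have {}fX : map (linfun f) X = Y by rewrite -fX; apply: eq_map => v; rewrite lfunE.
exists (linfun f); rewrite -dimv_eq0; have := limg_ker_dim (linfun f) fullv.
rewrite capfv -{1}(span_basis (vbasisP {:vT1})) limg_span fX.
have -> : \dim <<Y>> = \dim {:vT1} by rewrite -sY; apply/eqP.
by move=> /eqP; rewrite -[X in _ == X]add0n eqn_add2r.
Qed.

Section Spreads.
Variables (R : realFieldType) (F : finFieldType) (n : nat).
Local Notation V := 'rV[F]_n.
Local Notation q := (#|F|%:R : R).
Local Notation sp := {vspace V}.
Implicit Types (A S : {set sp}) (d k : nat) (x y z P H U : sp).
Local Notation dsp := (@dsp F n).

Definition partial_spread S := forall x y, x \in S -> y \in S -> x != y -> (x :&: y = 0)%VS.

(* Graphs of the multiplication maps u |-> a u from a k-space into a field of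
   degree n - k. *)
Lemma exists_partial_spread k : (0 < k)%N -> (2 * k <= n)%N ->
  exists S, [/\ S \subset dsp k, #|S| = (#|F| ^ (n - k))%N & partial_spread S].
Proof.
move=> k0 kn; have e0 : (0 < n - k)%N by lia.
have [L dL] := exists_field_ext F e0.
have [iota iota_inj] : exists f : 'Hom('rV[F]_k, L), lker f == 0%VS.
  by apply: exists_embedding; rewrite dL dim_fullrV; lia.
have [Phi Phi_inj] : exists f : 'Hom(('rV[F]_k * L)%type, V), lker f == 0%VS.
  apply: exists_embedding; rewrite dim_fullrV.
  have -> : \dim {:('rV[F]_k * L)%type} = (\dim {:'rV[F]_k} + \dim {:L})%N by rewrite !dimvf.
  by rewrite dim_fullrV dL; lia.
pose g (a : L) (u : 'rV[F]_k) : V := Phi (u, a * iota u).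
have g_lin a : linear (g a).
  move=> c u v; rewrite /g -linearP; congr (Phi _).
  by rewrite linearP mulrDr -scalerAr.
pose G a : {linear 'rV[F]_k -> V} := HB.pack (g a) (GRing.isLinear.Build _ _ _ _ (g a) (g_lin a)).
pose X a : sp := (linfun (G a) @: fullv)%VS.
have G_ker a : lker (linfun (G a)) == 0%VS.
  apply/lker0P => u v; rewrite !lfunE /= /g => /(elimT lker0P Phi_inj).
  by case.
have dX a : \dim (X a) = k.
  by rewrite limg_dim_eq ?dim_fullrV // (eqP (G_ker a)) capv0.
have Xab a b : a != b -> (X a :&: X b = 0)%VS.
  move=> ab; apply/eqP; rewrite -subv0; apply/subvP => w; rewrite memv_cap memv0.
  case/andP => /memv_imgP[u _ wu] /memv_imgP[v _ wv].
  move: (wv); rewrite {1}wu !lfunE /= /g => /(elimT lker0P Phi_inj)[uv].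
  rewrite -uv => /eqP; rewrite -subr_eq0 -mulrBl mulf_eq0 subr_eq0 (negPf ab) /=.
  move=> /eqP h; have {h} : iota u = iota 0 by rewrite h linear0.
  by move/(elimT lker0P iota_inj) => u0; rewrite wu u0 linear0.
have X_inj : injective X.
  move=> a b e; apply/eqP; apply: contraT => /Xab.
  rewrite -e capvv => /(congr1 (fun U => \dim U)).
  by rewrite dX dimv0 => k00; move: k0; rewrite k00.
exists [set X a | a : finvect_type L]; split.
- by apply/subsetP => x /imsetP[a _ ->]; rewrite in_dsp dX.
- rewrite card_imset // -dL -(@card_vspace F (finvect_type L) _ (fullv : {vspace L})).
  by apply: eq_card => a; rewrite memvf.
- move=> x y /imsetP[a _ ->] /imsetP[b _ ->] ab.
  by apply: Xab; apply: contra ab => /eqP ->.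
Qed.

(** * Averaging over the general linear group *)

Definition gl : {set finvect_type 'End(V)} :=
  [set f : finvect_type 'End(V) | lker (f : 'End(V)) == 0%VS].

(** Bases of [x] and [y], each extended by a basis of a complement, are matched. *)
Lemma exists_gl_map x y : \dim x = \dim y ->
  exists2 f : 'End(V), lker f == 0%VS & (f @: x)%VS = y.
Proof.
move=> dxy; pose X := vbasis x ++ vbasis (x^C)%VS; pose Y := vbasis y ++ vbasis (y^C)%VS.
have bX (U : sp) : basis_of fullv (vbasis U ++ vbasis (U^C)%VS).
  rewrite -(addv_complf U); apply: cat_basis; rewrite ?vbasisP //.
  by rewrite directvE /= dimv_disjoint_sum // capv_compl.
have sz : size X = size Y by rewrite !size_cat !size_tuple !dimv_compl dxy.
have [f /(_ (basis_free (bX x)) (esym sz)) fX] := linear_of_free X Y.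
have {}fX : map (linfun f) X = Y by rewrite -fX; apply: eq_map => v; rewrite lfunE.
exists (linfun f).
  rewrite -dimv_eq0; have := limg_ker_dim (linfun f) fullv.
  rewrite capfv -{1}(span_basis (bX x)) limg_span fX (span_basis (bX y)).
  by move=> /eqP; rewrite -{2}[\dim fullv]add0n eqn_add2r.
have sxy : size (vbasis x) = size (vbasis y) by rewrite !size_tuple.
rewrite -{1}(span_basis (vbasisP x)) limg_span.
have -> : map (linfun f) (vbasis x) = vbasis y.
  have := congr1 (take (size (vbasis y))) fX; rewrite map_cat take_size_cat ?size_map //.
  by rewrite take_size_cat.
exact: (span_basis (vbasisP y)).
Qed.

(** The number of maps sending [x] to y is the same for all y: composing with an invertible map from
    y to z injects one fibre into the other. *)
Lemma sum_gl k x (phi : sp -> R) : x \in dsp k ->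
  #|dsp k|%:R * \sum_(f in gl) phi ((f : 'End(V)) @: x)%VS
    = #|gl|%:R * \sum_(y in dsp k) phi y.
Proof.
move=> xk; pose c y := #|[set f in gl | ((f : 'End(V)) @: x)%VS == y]|.
have fk (f : finvect_type 'End(V)) : f \in gl -> ((f : 'End(V)) @: x)%VS \in dsp k.
  rewrite inE => /eqP f0; move: xk; rewrite !in_dsp => /eqP <-.
  by rewrite limg_dim_eq // f0 capv0.
have split_sum (psi : sp -> R) : \sum_(f in gl) psi ((f : 'End(V)) @: x)%VS =
    \sum_(y in dsp k) (c y)%:R * psi y.
  rewrite (partition_big (fun f : finvect_type 'End(V) => ((f : 'End(V)) @: x)%VS) (mem (dsp k)) fk) /=.
  apply: eq_bigr => y _; rewrite (eq_bigr (fun=> psi y)); last by move=> f /andP[_ /eqP ->].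
  rewrite sumr_const mulr_natl; congr (_ *+ _).
  by apply: eq_card => f; rewrite [LHS]unfold_in /= !inE.
have c_const y z : y \in dsp k -> z \in dsp k -> (c y <= c z)%N.
  rewrite !in_dsp => /eqP dy /eqP dz.
  have [h h0 hyz] := exists_gl_map (etrans dy (esym dz)).
  pose H (f : finvect_type 'End(V)) : finvect_type 'End(V) := (h \o (f : 'End(V)))%VF.
  have H_inj : injective H.
    move=> f g e; apply: (can_inj (g := fun f : 'End(V) => (h^-1 \o f)%VF) _ e) => f'.
    by rewrite /H comp_lfunA lker0_compVf // comp_lfun1l.
  rewrite /c -(card_imset _ H_inj) subset_leq_card //; apply/subsetP => g /imsetP[f].
  rewrite !inE => /andP[f0 /eqP fxy] ->; rewrite /H limg_comp fxy hyz eqxx andbT.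
  apply/lker0P => u v; rewrite !comp_lfunE => /(elimT lker0P h0).
  exact: (elimT lker0P f0).
have cE y : y \in dsp k -> #|dsp k|%:R * (c y)%:R = #|gl|%:R :> R.
  move=> yk; transitivity (\sum_(f in gl) (1 : R)); last by rewrite sumr_const.
  rewrite (split_sum (fun=> 1)) -sumr_const mulr_suml; apply: eq_bigr => z zk.
  rewrite mul1r mulr1; congr (_%:R); apply/eqP.
  by rewrite eqn_leq !c_const.
rewrite split_sum !mulr_sumr; apply: eq_bigr => y yk.
by rewrite mulrA cE.
Qed.

(** A fixed partial spread is moved by all of [gl]. Each of its members becomes equidistributed over
    the [k]-spaces, so some image is no worse than the mean. *)
Lemma exists_spread_below_mean k (phi : sp -> R) : (0 < k)%N -> (2 * k <= n)%N ->
  exists S, [/\ S \subset dsp k, #|S| = (#|F| ^ (n - k))%N, partial_spread S &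
    #|dsp k|%:R * \sum_(x in S) phi x <= #|S|%:R * \sum_(y in dsp k) phi y].
Proof.
move=> k0 kn; have [S [Sk cS dS]] := exists_partial_spread k0 kn.
have id_gl : (\1%VF : finvect_type 'End(V)) \in gl.
  by rewrite inE; apply/lker0P => u v; rewrite !id_lfunE.
have gl0 : 0 < #|gl|%:R :> R by rewrite ltr0n; apply/card_gt0P; exists \1%VF.
pose Psi (f : finvect_type 'End(V)) := \sum_(x in S) phi ((f : 'End(V)) @: x)%VS.
have avg : #|dsp k|%:R * \sum_(f in gl) Psi f = #|gl|%:R * (#|S|%:R * \sum_(y in dsp k) phi y).
  rewrite exchange_big /= mulr_sumr (eq_bigr (fun=> #|gl|%:R * \sum_(y in dsp k) phi y)).
    by rewrite sumr_const -mulr_natl; ring.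
  by move=> x /(subsetP Sk) xk; rewrite sum_gl.
have [f fgl hf] : exists2 f, f \in gl &
    #|dsp k|%:R * Psi f <= #|S|%:R * \sum_(y in dsp k) phi y.
  apply/exists_inP; apply: contraT; rewrite negb_exists_in => /forall_inP hno.
  have : \sum_(f in gl) (#|S|%:R * \sum_(y in dsp k) phi y) < \sum_(f in gl) #|dsp k|%:R * Psi f.
    apply: ltr_sum => [|f /hno]; last by rewrite -ltNge.
    by apply/hasP; exists (\1%VF : finvect_type _); rewrite ?mem_index_enum.
  by rewrite sumr_const -[X in _ < X]mulr_sumr avg -[_ *+ #|gl|]mulr_natl ltxx.
move: fgl; rewrite inE => f0.
have f_inj : injective (fun x : sp => ((f : 'End(V)) @: x)%VS).
  by move=> x y /eqP; rewrite eq_limg_ker0 // => /eqP.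
exists [set ((f : 'End(V)) @: x)%VS | x in S]; split.
- apply/subsetP => y /imsetP[x /(subsetP Sk) xk ->]; move: xk.
  by rewrite !in_dsp limg_dim_eq // (eqP f0) capv0.
- by rewrite card_imset.
- move=> _ _ /imsetP[x xS ->] /imsetP[y yS ->] xy.
  rewrite -lker0_img_cap // dS // ?limg0 //.
  by apply: contra xy => /eqP ->.
- by rewrite card_imset // big_imset //= => x y _ _; apply: f_inj.
Qed.

End Spreads.

(** * A pencil rich in members of a large family *)

Section FindPencil.
Variables (R : realFieldType) (F : finFieldType) (n : nat).
Local Notation V := 'rV[F]_n.
Local Notation q := (#|F|%:R : R).
Local Notation "[ a ]q" := (qnum q a) (at level 0, a at level 99).
Local Notation sp := {vspace V}.
Let q_gt1 : 1 < q := cardF_gt1 R F.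
Hint Resolve q_gt1 : core.
Implicit Types (A S C Y Pi : {set sp}) (d k s : nat) (x y z P H U : sp).
Local Notation dsp := (@dsp F n).

Definition spread_bounded s Y := forall S, S \subset Y -> partial_spread S -> (#|S| <= s)%N.

Lemma partial_spread_sub S C : C \subset S -> partial_spread S -> partial_spread C.
Proof. by move=> /subsetP h hS x y /h xS /h; exact: hS. Qed.

Lemma partial_spreadU1 S y : partial_spread S -> (forall x, x \in S -> (x :&: y = 0)%VS) ->
  partial_spread (y |: S).
Proof.
move=> hS hy x z; rewrite !inE => /orP[/eqP->|xS] /orP[/eqP->|zS].
- by rewrite eqxx.
- by rewrite capvC => _; exact: hy.
- by move=> _; exact: hy.
- exact: hS.
Qed.

Lemma capvv_neq0 k x : (0 < k)%N -> x \in dsp k -> (x :&: x)%VS != 0%VS.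
Proof. by move=> k0; rewrite in_dsp capvv -dimv_eq0 => /eqP ->; rewrite -lt0n. Qed.

Lemma spread_bounded_cover k Y C : (0 < k)%N -> Y \subset dsp k ->
  C \subset Y -> partial_spread C ->
  (forall S, S \subset Y -> partial_spread S -> (#|S| <= #|C|)%N) ->
  forall y, y \in Y -> exists2 x, x \in C & (x :&: y)%VS != 0%VS.
Proof.
move=> k0 Yk CY hC Cmax y yY; apply/exists_inP; apply: contraT.
rewrite negb_exists_in => /forall_inP h.
have hy x : x \in C -> (x :&: y = 0)%VS by move=> /h; rewrite negbK => /eqP.
have yC : y \notin C.
  by apply/negP => yC; move: (capvv_neq0 k0 (subsetP Yk _ yY)); rewrite hy // eqxx.
have := Cmax (y |: C); rewrite subUset sub1set yY CY => /(_ isT (partial_spreadU1 hC hy)).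
by rewrite cardsU1 yC add1n ltnn.
Qed.

Lemma exists_maximal_spread Y : exists C, [/\ C \subset Y, partial_spread C &
  forall S, S \subset Y -> partial_spread S -> (#|S| <= #|C|)%N].
Proof.
pose p (S : {set sp}) := (S \subset Y) &&
  [forall x in S, forall y in S, (x != y) ==> ((x :&: y)%VS == 0%VS)].
have pP S : reflect (S \subset Y /\ partial_spread S) (p S).
  apply: (iffP andP) => -[SY h]; split=> //.
    move=> x y xS yS xy; apply/eqP.
    by move/forall_inP: h => /(_ x xS) /forall_inP /(_ y yS); rewrite xy.
  by apply/forall_inP => x xS; apply/forall_inP => y yS; apply/implyP => xy; apply/eqP; exact: h.
have p0 : p set0 by apply/pP; split; [exact: sub0set | move=> x y; rewrite inE].
case: (arg_maxnP (fun S : {set sp} => #|S|) p0) => C /pP[CY hC] Cmax.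
by exists C; split=> // S SY hS; apply: Cmax; apply/pP.
Qed.

(** Each member of [Y] contains one of the at most s[k] points of a maximal clique. If all their
    degrees were at most s * al * E, then [Y] would have at most s * E / 4 members. *)
Lemma find_pencil_large k s Y (E al : R) : (0 < k)%N ->
  Y \subset dsp k -> spread_bounded s Y -> 0 < E -> 0 <= al ->
  (s%:R - 1 / 1000) * E <= #|Y|%:R -> (0 < s)%N -> s%:R * [k]q * al <= 1 / 4 ->
  exists2 Pi, is_pencil k Pi & s%:R * al * E < #|Y :&: Pi|%:R.
Proof.
move=> k0 Yk Ys E0 al0 cY s0 hal.
have [C [CY hC Cmax]] := exists_maximal_spread Y.
have cover := spread_bounded_cover k0 Yk CY hC Cmax.
have Cs := Ys C CY hC.
have [[P Pp hP]|] : (exists2 P, P \in dsp 1 & s%:R * al * E < deg R Y P) \/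
    (forall P, P \in dsp 1 -> deg R Y P <= s%:R * al * E).
  case: (boolP [exists P in dsp 1, s%:R * al * E < deg R Y P]) => [/exists_inP|]; first by left.
  by rewrite negb_exists_in => /forall_inP h; right => P /h; rewrite -leNgt.
- exists (star k P); first by apply: StarPencil; apply/eqP; rewrite -in_dsp.
  apply: lt_le_trans hP _; rewrite degE ler_nat subset_leq_card //; apply/subsetP => y.
  rewrite !inE => /andP[yY Py]; rewrite yY Py andbT /=.
  by move: (subsetP Yk _ yY); rewrite in_dsp.
move=> hP; exfalso.
have : #|Y|%:R <= \sum_(x in C) \sum_(P in dsp 1) (P <= x)%VS%:R * deg R Y P.
  under eq_bigr => x _ do under eq_bigr => P _ do rewrite /deg mulr_sumr.
  under eq_bigr => x _ do rewrite exchange_big /=.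
  rewrite exchange_big /= -sumr_const; apply: ler_sum => y yY.
  have [x xC xy] := cover y yY.
  pose P : sp := (<[vpick (x :&: y)]>)%VS.
  have Pxy : (P <= x :&: y)%VS by rewrite -memvE memv_pick.
  have Pp : P \in dsp 1 by rewrite in_dsp dim_vline vpick0 xy.
  move: Pxy; rewrite subv_cap => /andP[Px Py].
  rewrite (bigD1 x xC) /= (bigD1 P Pp) /= Px Py mulr1 -addrA lerDl.
  apply: addr_ge0; first by apply: sumr_ge0 => *; rewrite mulr_ge0 ?ler0n.
  by apply: sumr_ge0 => *; apply: sumr_ge0 => *; rewrite mulr_ge0 ?ler0n.
move=> h; have : #|Y|%:R <= \sum_(x in C) [k]q * (s%:R * al * E).
  apply: le_trans h _; apply: ler_sum => x xC.
  have /eqP <- : \dim x == k by rewrite -in_dsp (subsetP Yk) // (subsetP CY).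
  rewrite -sum_pts mulr_suml; apply: ler_sum => P Pp.
  by rewrite ler_wpM2l ?ler0n // hP.
rewrite sumr_const -[_ *+ #|C|]mulr_natr => h2.
have sR : 1 <= s%:R :> R by rewrite ler1n.
have b0 : 0 <= [k]q * (s%:R * al * E).
  by rewrite mulr_ge0 ?qnum_ge0 // mulr_ge0 ?(ltW E0) // mulr_ge0 ?ler0n.
have h3 : [k]q * (s%:R * al * E) * #|C|%:R <= [k]q * (s%:R * al * E) * s%:R.
  by rewrite ler_wpM2l // ler_nat.
have h4 : s%:R * [k]q * al * (s%:R * E) <= 1 / 4 * (s%:R * E).
  by rewrite ler_wpM2r // mulr_ge0 ?ler0n ?(ltW E0).
have h5 : 1 * E <= s%:R * E by rewrite ler_wpM2r // ltW.
by clear -cY h2 h3 h4 h5 E0; lra.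
Qed.

(** * Members meeting a clique, and members meeting it only once *)

Definition meeting Y x : {set sp} := [set y in Y | (x :&: y)%VS != 0%VS].

Lemma sum_meeting_le k Y : (0 < k <= n)%N -> Y \subset dsp k ->
  \sum_(x in Y) #|meeting Y x|%:R
    <= #|Y|%:R * (gbin q n.-1 k.-1 + [k]q ^+ 2 / [n]q * #|Y|%:R).
Proof.
move=> kn Yk; apply: le_trans (var_deg R kn Yk); rewrite sum_deg_sqr.
apply: ler_sum => x xY; rewrite card_filter_sum; apply: ler_sum => y yY.
rewrite gbin1 //; case: eqP => [_|/eqP d0]; first exact: qnum_ge0.
have d1 : (0 < \dim (x :&: y))%N by rewrite lt0n dimv_eq0.
by apply: le_trans (ler_qnum q_gt1 d1); rewrite qnum1.
Qed.

Definition private_set Y C x : {set sp} :=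
  [set y in Y | ((x :&: y)%VS != 0%VS) && [forall z in C :\ x, (z :&: y)%VS == 0%VS]].

(** Two disjoint private members could replace [x] in [C], giving s + 1 pairwise disjoint members of
    [Y]. *)
Lemma private_intersecting k s Y C x : (0 < k)%N -> Y \subset dsp k -> spread_bounded s Y ->
  C \subset Y -> partial_spread C -> #|C| = s -> x \in C -> intersecting (private_set Y C x).
Proof.
move=> k0 Yk Ys CY hC cC xC y z; rewrite !inE.
move=> /and3P[yY xy /forall_inP hy] /and3P[zY xz /forall_inP hz].
apply/negP => /eqP yz.
have hy' w : w \in C :\ x -> (w :&: y = 0)%VS by move=> /hy /eqP.
have hz' w : w \in C :\ x -> (w :&: z = 0)%VS by move=> /hz /eqP.
have s1 : partial_spread (y |: C :\ x).
  by apply: partial_spreadU1 => //; apply: partial_spread_sub hC; exact: subD1set.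
have s2 : partial_spread (z |: (y |: C :\ x)).
  by apply: partial_spreadU1 => // w; rewrite in_setU1 => /orP[/eqP -> //|]; exact: hz'.
have self w : w \in Y -> (w :&: w)%VS != 0%VS.
  by move=> wY; apply: capvv_neq0 k0 (subsetP Yk _ wY).
have yC : y \notin C :\ x.
  by apply/negP => /hy' e; move: (self y yY); rewrite e eqxx.
have zC : z \notin y |: C :\ x.
  rewrite in_setU1 negb_or; apply/andP; split.
    by apply/eqP => e; move: (self y yY); rewrite -{2}e yz eqxx.
  by apply/negP => /hz' e; move: (self z zY); rewrite e eqxx.
have := Ys (z |: (y |: C :\ x)) ; rewrite !subUset !sub1set zY yY (subset_trans (subD1set _ _) CY).
move=> /(_ isT s2); rewrite cardsU1 zC cardsU1 yC.
by have := cardsD1 x C; rewrite xC cC => ->; rewrite !add1n ltnn.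
Qed.

(** Averaging over partial spreads yields a clique [C] of size [s] in [Y] with few incidences. Some
    member of [C] then has a private set of size at least 8/9 E, to which [intersecting_pencil]
    applies. *)
Lemma find_pencil_small k s Y (E kap al M0 : R) :
  (1 < k)%N -> (2 * k <= n)%N -> (1 < s)%N -> Y \subset dsp k -> spread_bounded s Y ->
  E = gbin q n.-1 k.-1 -> M0 = [k.-1]q * [n - k.-1]q -> kap = [k]q ^+ 2 / [n]q ->
  (s%:R - 1 / 1000) * E <= #|Y|%:R ->
  s%:R * kap <= 1 / 15 -> s%:R * al <= 1 / 15 ->
  s%:R <= 1 / 90 * q ^+ k ->
  [k]q <= 1 / 100 * M0 ->
  ((2 * k < n)%N -> [k - 2]q * (q * [n - k]q) + 2 * ([k]q * (q * [k.-1]q)) < 6 / 10 * M0) ->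
  (n = (2 * k)%N -> [k - 2]q * (q * [k]q) + 2 * ([k.-1]q * (q * [k.-1]q)) +
      [k]q * (q * [k - 2]q) < 6 / 10 * M0) ->
  exists2 Pi, is_pencil k Pi & s%:R * al * E < #|Y :&: Pi|%:R.
Proof.
move=> k1 kn s1 Yk Ys eE eM ek cY hkap hal hq t1 t2 t3.
have k0 : (0 < k)%N by exact: ltnW.
have kn' : (0 < k <= n)%N by clear -k1 kn; lia.
have E0 : 0 < E by rewrite eE gbin_gt0 //; clear -k1 kn; lia.
have s2 : 2 <= s%:R :> R by rewrite ler_nat.
have kap0 : 0 <= kap by rewrite ek divr_ge0 ?sqr_ge0 // qnum_ge0.
have kap30 : kap <= 30^-1.
  have h : 2 * kap <= s%:R * kap by rewrite ler_wpM2r.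
  by clear -h hkap; lra.
set N := #|dsp k|%:R : R.
have NE : N * [k]q = [n]q * E.
  rewrite /N card_dsp eE; have -> : k = k.-1.+1 by rewrite prednK.
  by rewrite gbin_absorb.
pose Q := q ^+ (n - k).
have Q0 : 0 < Q by apply: qX_gt0.
have bk0 : 0 < [k]q by exact: qnum_gt0.
have bn0 : 0 < [n]q by apply: qnum_gt0 => //; clear -k1 kn; lia.
have qk0 : 0 < q ^+ k by apply: qX_gt0.
have nE : [n]q = Q * [k]q + [n - k]q.
  by rewrite -qnumD // subnKC //; clear -k1 kn; lia.
have nkE : [n - k]q * q ^+ k <= [n]q.
  have -> : [n]q = q ^+ k * [n - k]q + [k]q.
    by rewrite -qnumD // subnK //; clear -k1 kn; lia.
  by rewrite mulrC lerDl ltW.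
(* Together with [QE2] this places N / Q between E and E * q^k / (q^k - 1). *)
have QE : Q * E <= N.
  rewrite -(ler_pM2r bk0) NE nE mulrDl mulrAC lerDl.
  by rewrite mulr_ge0 ?(ltW E0) ?qnum_ge0.
have QE2 : N * (q ^+ k - 1) <= Q * E * q ^+ k.
  rewrite -(ler_pM2r bk0) mulrAC NE -subr_ge0.
  have -> : Q * E * q ^+ k * [k]q - [n]q * E * (q ^+ k - 1) = E * ([n]q - [n - k]q * q ^+ k).
    by rewrite nE; ring.
  by rewrite mulr_ge0 ?(ltW E0) // subr_ge0.
have N0 : 0 < N by apply: lt_le_trans QE; rewrite mulr_gt0.
set y0 := #|Y|%:R : R in cY *.
have cS S : #|S| = (#|F| ^ (n - k))%N -> #|S|%:R = Q by move=> ->; rewrite natrX.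
have sumY (f : sp -> R) : \sum_(y in dsp k) (y \in Y)%:R * f y = \sum_(y in Y) f y.
  rewrite [RHS](eq_bigl (fun y => (y \in dsp k) && (y \in Y))); last first.
    by move=> y; case yY : (y \in Y); rewrite ?andbF // (subsetP Yk _ yY).
  rewrite [RHS]big_mkcondr; apply: eq_bigr => y _.
  by case: (y \in Y); rewrite ?mul1r ?mul0r.
have sumSY S (f : sp -> R) : \sum_(y in S) (y \in Y)%:R * f y = \sum_(y in S :&: Y) f y.
  rewrite [RHS](eq_bigl (fun y => (y \in S) && (y \in Y))); last by move=> y; rewrite inE.
  rewrite [RHS]big_mkcondr; apply: eq_bigr => y _.
  by case: (y \in Y); rewrite ?mul1r ?mul0r.
have SYs S : partial_spread S -> (#|S :&: Y| <= s)%N.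
  by move=> hS; apply: Ys; [exact: subsetIr | apply: partial_spread_sub hS; exact: subsetIl].
(* With minus the indicator of [Y] as [phi], a spread below the mean has at least the average number
   of members in [Y], yet at most [s]. *)
have Yub : Q * y0 <= N * s%:R.
  have [S [Sk /cS SQ hS]] := exists_spread_below_mean (fun y => (y \in Y)%:R * (-1 : R)) k0 kn.
  rewrite sumY sumSY !sumr_const SQ !mulNrn !mulrN lerN2 => h.
  by apply: le_trans h _; rewrite ler_pM2l // ler_nat SYs.
(* Passing from E to N / Q costs at most s / q^k <= 1/90, and 1/1000 + 1/90 < 1/50. *)
have Ylb : N * (s%:R - 1 / 50) <= Q * y0.
  have h1 : Q * ((s%:R - 1 / 1000) * E) <= Q * y0 by rewrite ler_pM2l.
  have h2 : (s%:R - 1 / 1000) * (N * (q ^+ k - 1)) <= (s%:R - 1 / 1000) * (Q * E * q ^+ k).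
    by rewrite ler_wpM2l //; clear -s2; lra.
  have h3 : N * s%:R <= N * (1 / 90 * q ^+ k) by rewrite ler_pM2l.
  rewrite -(ler_pM2r qk0).
  have h4 := ler_wpM2r (ltW qk0) h1.
  have h5 : 0 <= N * q ^+ k by rewrite mulr_ge0 // ltW.
  by clear -h2 h3 h4 h5 N0; lra.
(* q^k >= 90 s >= 180, so q^k / (q^k - 1) <= 180/179. *)
have Yub2 : y0 <= 180 / 179 * (s%:R * E).
  have q180 : 180 <= q ^+ k by clear -hq s2; lra.
  have h1 : Q * y0 * (179 / 180 * q ^+ k) <= N * s%:R * (q ^+ k - 1).
    apply: le_trans (_ : N * s%:R * (179 / 180 * q ^+ k) <= _).
      by rewrite ler_wpM2r // mulr_ge0 ?(ltW qk0) // divr_ge0 ?ler0n.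
    by rewrite ler_wpM2l ?mulr_ge0 ?ler0n ?(ltW N0) //; clear -q180; lra.
  have h2 : s%:R * (N * (q ^+ k - 1)) <= s%:R * (Q * E * q ^+ k) by rewrite ler_wpM2l ?ler0n.
  have Qk : 0 < Q * q ^+ k by rewrite mulr_gt0.
  rewrite -(ler_pM2l Qk); clear -h1 h2; lra.
have ky0 : kap * y0 <= 12 / 179 * E.
  have h1 : kap * y0 <= kap * (180 / 179 * (s%:R * E)) by rewrite ler_wpM2l.
  have h2 : s%:R * kap * E <= 1 / 15 * E by rewrite ler_wpM2r // ltW.
  by clear -h1 h2; lra.
(* The term -11/10 s E rewards spreads with many members in Y: below the mean,
   a spread has s members in Y, and these meet few members of Y. *)
have [S [Sk /cS SQ hS]] := exists_spread_below_mean
  (fun y => (y \in Y)%:R * (#|meeting Y y|%:R - 11 / 10 * (s%:R * E))) k0 kn.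
rewrite sumY sumSY !sumrB !sumr_const SQ -[_ *+ #|Y|]mulr_natr -[_ *+ #|S :&: Y|]mulr_natr -/N -/y0.
set C := S :&: Y; set T := \sum_(y in C) _; set W := \sum_(y in Y) _ => hT.
have T0 : 0 <= T by rewrite sumr_ge0.
have W_ub : W <= y0 * (E + 12 / 179 * E).
  have h := sum_meeting_le kn' Yk; rewrite -/W -/y0 -eE -ek in h.
  by apply: le_trans h _; rewrite ler_wpM2l ?ler0n // lerD2l.
have y00 : 0 <= y0 by rewrite ler0n.
have hT2 : T - 11 / 10 * (s%:R * E) * #|C|%:R <= (s%:R - 1 / 50) * (191 / 179 * E - 11 / 10 * (s%:R * E)).
  rewrite -(ler_pM2l N0); apply: le_trans hT _.
  have h1 : Q * W <= Q * (y0 * (E + 12 / 179 * E)) by rewrite ler_pM2l.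
  have h0 : 0 <= 11 / 10 * (s%:R * E) - 191 / 179 * E.
    have : 2 * E <= s%:R * E by rewrite ler_pM2r.
    by clear -E0; lra.
  have h2 := ler_wpM2r h0 Ylb.
  by clear -h1 h2; lra.
have C_le : (#|C| <= s)%N by exact: SYs.
have sE : 0 < s%:R * E by rewrite mulr_gt0 // ltr0n; clear -s1; lia.
(* With at most s - 1 members in [C] and T >= 0, the bound [hT2] would fail, since 191/179 + 11/500
   < 11/10. *)
have cC : #|C| = s.
  apply/eqP; rewrite eqn_leq C_le /= leqNgt; apply/negP => Cs.
  have h1 : #|C|%:R + 1 <= s%:R :> R by rewrite natr1 ler_nat.
  have h2 : 0 <= s%:R * E * (s%:R - (#|C|%:R + 1)) by rewrite mulr_ge0 ?(ltW sE) // subr_ge0.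
  by clear -h2 hT2 T0 sE E0; lra.
have T_ub : T <= 11 / 10 * (s%:R * E).
  rewrite cC in hT2; have : 2 * E <= s%:R * E by rewrite ler_pM2r.
  by clear -hT2 E0; lra.
have CY : C \subset Y by exact: subsetIr.
have hC : partial_spread C by apply: partial_spread_sub hS; exact: subsetIl.
have cover : forall y, y \in Y -> exists2 x, x \in C & (x :&: y)%VS != 0%VS.
  by apply: (spread_bounded_cover k0 Yk CY hC) => S' S'Y hS'; rewrite cC; exact: Ys.
(* Every y in [Y] meets [C], so it is either private to one member or counted at least twice in
   [T]. *)
have priv : 2 * y0 - T <= \sum_(x in C) #|private_set Y C x|%:R.
  have -> : \sum_(x in C) #|private_set Y C x|%:R = \sum_(x in C) \sum_(y in Y)
      (((x :&: y)%VS != 0%VS) && [forall z in C :\ x, (z :&: y)%VS == 0%VS])%:R :> R.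
    by apply: eq_bigr => x _; rewrite card_filter_sum.
  have -> : T = \sum_(x in C) \sum_(y in Y) ((x :&: y)%VS != 0%VS)%:R.
    by apply: eq_bigr => x _; rewrite card_filter_sum.
  rewrite lerBlDr -[y0]sumr_const mulr_sumr.
  rewrite exchange_big /= [X in _ + X]exchange_big /= -big_split /=; apply: ler_sum => y yY.
  have [x xC xy] := cover y yY; rewrite mulr1.
  have ge0 (I : finType) (P : pred I) (f : I -> bool) : 0 <= \sum_(i | P i) (f i)%:R :> R.
    by apply: sumr_ge0 => *; exact: ler0n.
  case: (boolP [exists z in C :\ x, (z :&: y)%VS != 0%VS]) => [/exists_inP[z zC zy]|].
    apply: le_trans (_ : 0 + 2 <= _); first by rewrite add0r.
    apply: lerD; first by apply: sumr_ge0 => *; exact: ler0n.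
    move: zC; rewrite in_setD1 => /andP[zx zC].
    have zc : (z \in C) && (z != x) by rewrite zC zx.
    rewrite (bigD1 x xC) /= xy (bigD1 z zc) /= zy addrA lerDl.
    by apply: sumr_ge0 => *; exact: ler0n.
  rewrite negb_exists_in => /forall_inP h.
  apply: lerD; rewrite (bigD1 x xC) /= xy /=.
    have -> : [forall z in C :\ x, (z :&: y)%VS == 0%VS].
      by apply/forall_inP => z /h; rewrite negbK.
    by rewrite lerDl; apply: sumr_ge0 => *; exact: ler0n.
  by rewrite lerDl; apply: sumr_ge0 => *; exact: ler0n.
(* 2 (s - 1/1000) E - 11/10 s E exceeds 8/9 s E. *)
have [x xC hx] : exists2 x, x \in C & 8 / 9 * E <= #|private_set Y C x|%:R.
  apply/exists_inP; apply: contraT; rewrite negb_exists_in => /forall_inP hno.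
  have : \sum_(x in C) #|private_set Y C x|%:R <= \sum_(x in C) 8 / 9 * E.
    by apply: ler_sum => x /hno; rewrite -ltNge => /ltW.
  rewrite sumr_const -[_ *+ #|C|]mulr_natr cC => h.
  have : 2 * E <= s%:R * E by rewrite ler_pM2r.
  by clear -h priv T_ub cY E0; lra.
have Ak : private_set Y C x \subset dsp k.
  by apply: subset_trans Yk; apply/subsetP => y; rewrite inE => /andP[].
have [Pi hPi cPi] := intersecting_pencil k1 kn Ak
  (private_intersecting k0 Yk Ys CY hC cC xC) eE eM ek kap30 hx t1 t2 t3.
exists Pi => //; apply: lt_le_trans (_ : 8 / 45 * E <= _).
  by rewrite ltr_pM2r //; clear -hal; lra.
apply: le_trans cPi _; rewrite ler_nat subset_leq_card // setSI //.
by apply/subsetP => y; rewrite inE => /andP[].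
Qed.

End FindPencil.

(** * Removing pencils *)

Section Induction.
Variables (R : realFieldType) (F : finFieldType) (n : nat).
Local Notation V := 'rV[F]_n.
Local Notation q := (#|F|%:R : R).
Local Notation "[ a ]q" := (qnum q a) (at level 0, a at level 99).
Local Notation sp := {vspace V}.
Let q_gt1 : 1 < q := cardF_gt1 R F.
Hint Resolve q_gt1 : core.
Implicit Types (A S C Y Pi : {set sp}) (d k s : nat) (x y z P H U : sp).
Local Notation dsp := (@dsp F n).

Lemma card_meeting_le x A (c : R) :
  (forall y, y \in A -> (x :&: y)%VS != 0%VS -> exists2 Q, Q \in dsp 1 & (Q <= x)%VS && (Q <= y)%VS) ->
  (forall Q, Q \in dsp 1 -> (Q <= x)%VS -> deg R A Q <= c) ->
  #|meeting A x|%:R <= [\dim x]q * c.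
Proof.
move=> hQ hc; rewrite -sum_pts mulr_suml /meeting card_filter_sum.
apply: le_trans (_ : \sum_(Q in dsp 1) (Q <= x)%VS%:R * deg R A Q <= _); last first.
  apply: ler_sum => Q Qp; case Qx : (Q <= x)%VS; rewrite ?mul0r // !mul1r.
  exact: hc.
under [leRHS]eq_bigr => Q _ do rewrite /deg mulr_sumr.
rewrite exchange_big /=; apply: ler_sum => y yA.
have ge0 (I : finType) (p : pred I) (f g : I -> bool) : 0 <= \sum_(i | p i) (f i)%:R * (g i)%:R :> R.
  by apply: sumr_ge0 => *; rewrite mulr_ge0 ?ler0n.
case: (boolP ((x :&: y)%VS != 0%VS)) => [xy|_]; last exact: ge0.
have [Q Qp /andP[Qx Qy]] := hQ y yA xy.
by rewrite (bigD1 Q Qp) /= Qx Qy mulr1 lerDl ge0.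
Qed.

Lemma exists_common_point x y : (x :&: y)%VS != 0%VS ->
  exists2 Q, Q \in dsp 1 & (Q <= x)%VS && (Q <= y)%VS.
Proof.
move=> xy; exists (<[vpick (x :&: y)]>)%VS; first by rewrite in_dsp dim_vline vpick0 xy.
by rewrite -subv_cap -memvE memv_pick.
Qed.

Lemma deg_star k P Q : P \in dsp 1 -> Q \in dsp 1 -> P != Q -> (1 < k)%N ->
  deg R (star k P) Q = gbin q (n - 2) (k - 2).
Proof.
rewrite !in_dsp => /eqP dP /eqP dQ PQ k1.
have d2 := neq_points_dim dP dQ PQ.
rewrite -d2 -(@sum_above R F n (P + Q)%VS k) ?d2 // /deg.
rewrite (eq_bigl (fun y => (y \in dsp k) && (P <= y)%VS)); last by move=> y; rewrite !inE.
rewrite big_mkcondr; apply: eq_bigr => y _; rewrite subv_add.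
by case: (P <= y)%VS.
Qed.

Lemma card_star k P : P \in dsp 1 -> (0 < k)%N -> #|star k P|%:R = gbin q n.-1 k.-1.
Proof.
rewrite in_dsp => /eqP dP k0; rewrite /star card_filter_sum.
by rewrite sum_above dP ?subn1.
Qed.

(** A union bound over points. For a star, the [[k]q] points of [x] all differ from the centre. For
    a costar, only the at most [[k.-1]q] points of x :&: H matter. Absorption turns both bounds into
    al * E. *)
Lemma pencil_meet_le k Pi x (E al : R) : (1 < k)%N -> (2 * k <= n)%N ->
  E = gbin q n.-1 k.-1 -> al = [k]q * [k.-1]q / [n.-1]q ->
  is_pencil k Pi -> x \in dsp k -> x \notin Pi -> #|meeting Pi x|%:R <= al * E.
Proof.
move=> k1 kn eE eal; have n1 : [n.-1]q != 0 by apply: qnum_neq0 => //; clear -k1 kn; lia.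
have n0 : (0 < n)%N by clear -k1 kn; lia.
have kk : k.-1 = k.-2.+1 by clear -k1; lia.
case=> [P dP|H nk dH] xk xPi; have dx : \dim x = k by apply/eqP; rewrite -in_dsp.
  have -> : al * E = [\dim x]q * gbin q (n - 2) (k - 2).
    have e : [k.-1]q * E = [n.-1]q * gbin q (n - 2) (k - 2).
      rewrite eE kk mulrC gbin_absorb //; congr (_ * gbin _ _ _); clear; lia.
    rewrite dx eal; apply: (mulIf n1).
    transitivity ([k]q * ([k.-1]q * E)); first by field.
    by rewrite e; ring.
  apply: card_meeting_le => // [y _|Q Qp Qx]; first exact: exists_common_point.
  have PQ : P != Q by apply: contra xPi => /eqP e; rewrite inE xk e.
  by rewrite deg_star // in_dsp dP.
have xH : ~~ (x <= H)%VS by apply: contra xPi => xH; rewrite inE xk.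
have dxH : (\dim (x :&: H) <= k.-1)%N.
  have c := dimvS (capvSl x H); rewrite dx in c.
  have e : \dim (x :&: H) != k.
    apply: contra xH => /eqP e.
    have /eqP <- : (x :&: H == x)%VS by rewrite eqEdim capvSl dx e /=.
    exact: capvSr.
  by clear -c e; move: (\dim _) c e => m; lia.
have -> : al * E = [k.-1]q * gbin q (n - 2) k.-1.
  have e : E * [k]q = [n.-1]q * gbin q (n - 2) k.-1.
    have := @gbin_absorb2 R q q_gt1 n.-1 k.-1; rewrite -eE.
    have -> : (n.-1 - k.-1 = k)%N by clear -nk k1; lia.
    have -> : n.-1.-1 = (n - 2)%N by clear; lia.
    by apply; clear -k1 kn; lia.
  rewrite eal; apply: (mulIf n1).
  transitivity ([k.-1]q * (E * [k]q)); first by field.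
  by rewrite e; ring.
have -> : meeting (costar k H) x = meeting (costar k H) (x :&: H).
  apply/setP => y; rewrite !inE; case: (\dim y == k) => //=; case yH : (y <= H)%VS => //=.
  by rewrite -capvA (capv_idPr yH).
apply: le_trans (_ : [\dim (x :&: H)]q * gbin q (n - 2) k.-1 <= _); last first.
  by rewrite ler_wpM2r ?gbin_ge0 // ler_qnum.
apply: card_meeting_le => // [y _|Q Qp Qx]; first exact: exists_common_point.
move: (Qp); rewrite in_dsp => /eqP dQ.
have QH : (Q <= H)%VS by move: Qx; rewrite subv_cap => /andP[].
have := @sum_between R F n Q H k QH; rewrite dQ => /(_ (ltnW k1)).
rewrite dH !subn1 (_ : n.-1.-1 = (n - 2)%N); last by clear; lia.
move=> <-; rewrite le_eqVlt; apply/orP; left; apply/eqP; rewrite /deg.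
rewrite (eq_bigl (fun y => (y \in dsp k) && (y <= H)%VS)); last by move=> y; rewrite !inE.
by rewrite big_mkcondr; apply: eq_bigr => y _; case: (y <= H)%VS; rewrite ?andbT ?andbF.
Qed.

Lemma card_pencil_le k Pi : (1 < k)%N -> (2 * k <= n)%N ->
  is_pencil k Pi -> #|Pi|%:R <= gbin q n.-1 k.-1.
Proof.
move=> k1 kn [P dP|H nk dH].
  by rewrite card_star ?in_dsp ?dP // ltnW.
rewrite /costar card_filter_sum sum_below dH.
have kp := qnum_gt0 q_gt1 (ltnW k1).
rewrite -(ler_pM2r kp); have := @gbin_next R q q_gt1 n.-1 k.-1.
have -> : k.-1.+1 = k by clear -k1; lia.
have -> : (n.-1 - k.-1 = k)%N by clear -nk k1; lia.
by move=> ->; last by clear -k1 kn; lia.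
Qed.

Lemma pencil_intersecting k Pi : (1 < k)%N -> (2 * k <= n)%N -> is_pencil k Pi -> intersecting Pi.
Proof.
move=> k1 kn [P dP|H nk dH] x y; rewrite !inE => /andP[/eqP dx hx] /andP[/eqP dy hy].
  have : (P <= x :&: y)%VS by rewrite subv_cap hx hy.
  by move/dimvS; rewrite dP -dimv_eq0 -lt0n.
have := dimv_sum_cap x y; have : (x + y <= H)%VS by rewrite subv_add hx hy.
move/dimvS; rewrite dH dx dy -dimv_eq0; clear -nk k1.
by move: (\dim (x + y)) (\dim (x :&: y)) => a b; lia.
Qed.

(** s + 1 disjoint members outside [Pi] meet at most (s + 1) * al * E of its members, so some member
    of Y :&: Pi misses them all and gives s + 2 disjoint members. *)
Lemma spread_bounded_minus_pencil k s Y Pi (E al : R) : (1 < k)%N -> (2 * k <= n)%N ->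
  Y \subset dsp k ->
  E = gbin q n.-1 k.-1 -> al = [k]q * [k.-1]q / [n.-1]q ->
  is_pencil k Pi -> spread_bounded s.+1 Y -> s.+1%:R * al * E < #|Y :&: Pi|%:R ->
  spread_bounded s (Y :\: Pi).
Proof.
move=> k1 kn Yk eE eal hPi Ys hYPi S SY hS; rewrite leqNgt; apply/negP => sS.
have SY' : S \subset Y by apply: subset_trans SY _; exact: subsetDl.
have Ss := Ys S SY' hS.
suff [y yYPi hy] : exists2 y, y \in Y :&: Pi & forall x, x \in S -> (x :&: y = 0)%VS.
  move: yYPi; rewrite inE => /andP[yY yPi].
  have yS : y \notin S.
    by apply/negP => /(subsetP SY); rewrite inE yPi.
  have := Ys (y |: S); rewrite subUset sub1set yY SY' => /(_ isT (partial_spreadU1 hS hy)).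
  by rewrite cardsU1 yS add1n ltnNge sS.
case: (boolP [exists y in Y :&: Pi, [forall x in S, (x :&: y)%VS == 0%VS]]).
  by move=> /exists_inP[y yYPi /forall_inP h]; exists y => // x /h /eqP.
move=> hno; exfalso; suff : #|Y :&: Pi|%:R <= s.+1%:R * al * E by rewrite leNgt hYPi.
have h1 : #|Y :&: Pi|%:R <= \sum_(x in S) #|meeting Pi x|%:R :> R.
  under eq_bigr => x _ do rewrite /meeting card_filter_sum.
  rewrite exchange_big /= [leLHS](_ : _ = \sum_(y in Pi) (y \in Y)%:R); last first.
    by rewrite -card_filter_sum; congr (_%:R); apply: eq_card => y; rewrite !inE andbC.
  apply: ler_sum => y yPi; case yY : (y \in Y); last by apply: sumr_ge0 => *; exact: ler0n.
  have : ~~ [forall x in S, (x :&: y)%VS == 0%VS].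
    by apply: contra hno => h; apply/exists_inP; exists y => //; rewrite inE yY yPi.
  rewrite negb_forall_in => /exists_inP[x xS xy].
  by rewrite (bigD1 x xS) /= xy lerDl; apply: sumr_ge0 => *; exact: ler0n.
apply: le_trans h1 _; apply: le_trans (_ : \sum_(x in S) al * E <= _).
  apply: ler_sum => x xS; apply: (pencil_meet_le k1 kn eE eal hPi).
    by apply: (subsetP Yk); apply: (subsetP SY').
  by move/(subsetP SY): xS; rewrite inE => /andP[].
rewrite sumr_const -[_ *+ #|S|]mulr_natl -mulrA ler_wpM2r ?ler_nat //.
rewrite eE eal mulr_ge0 ?gbin_ge0 // divr_ge0 ?qnum_ge0 // mulr_ge0 ?qnum_ge0 //.
Qed.

Lemma partial_spread1 y : partial_spread [set y].
Proof. by move=> x z; rewrite !inE => /eqP -> /eqP ->; rewrite eqxx. Qed.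

(** Induction on [s], removing one pencil at a time. A pencil has at most E members, so the size
    bound survives with the same [tau]. At s = 1 the family itself is intersecting. *)
Lemma intersecting_cover k s Y (E al tau : R) : (1 < k)%N -> (2 * k <= n)%N ->
  Y \subset dsp k -> E = gbin q n.-1 k.-1 -> al = [k]q * [k.-1]q / [n.-1]q ->
  (forall s' Y', (1 < s' <= s)%N -> Y' \subset dsp k -> spread_bounded s' Y' ->
     (s'%:R - tau) * E <= #|Y'|%:R ->
     exists2 Pi, is_pencil k Pi & s'%:R * al * E < #|Y' :&: Pi|%:R) ->
  spread_bounded s Y -> (s%:R - tau) * E <= #|Y|%:R ->
  exists Z : 'I_s -> {set sp}, (forall i, Z i \subset Y /\ intersecting (Z i)) /\
    Y = \bigcup_(i < s) Z i.
Proof.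
move=> k1 kn + eE eal; elim: s Y => [|s IH] Y Yk hfind Ys cY.
  exists (fun=> set0); split=> [[]//|]; rewrite big_ord0; apply/setP => y; rewrite inE.
  apply/negP => yY; have := Ys [set y]; rewrite sub1set yY cards1.
  by move=> /(_ isT (@partial_spread1 y)).
case: s => [|s] in IH hfind Ys cY *.
  exists (fun=> Y); split; last by rewrite big_ord_recl big_ord0 setU0.
  move=> _; split=> // x y xY yY; apply/negP => /eqP xy.
  have xx := capvv_neq0 (ltnW k1) (subsetP Yk _ xY).
  have neq : y \notin [set x] by rewrite inE; apply: contra xx => /eqP e; rewrite -{2}e xy.
  have := Ys (y |: [set x]); rewrite subUset !sub1set xY yY cardsU1 neq cards1 => /(_ isT) h.
  suff /h : partial_spread (y |: [set x]) by [].
  by apply: partial_spreadU1 => [|a]; [exact: partial_spread1 | rewrite inE => /eqP ->].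
have [Pi hPi cPi] := hfind s.+2 Y (leqnn _) Yk Ys cY.
have Y'k : Y :\: Pi \subset dsp k by apply: subset_trans Yk; exact: subsetDl.
have [|||Z [hZ eZ]] := IH (Y :\: Pi) Y'k.
- by move=> s' Y' /andP[s1 s2]; apply: hfind; rewrite s1 ltnW.
- exact: (spread_bounded_minus_pencil k1 kn Yk eE eal hPi Ys cPi).
- have := card_pencil_le k1 kn hPi; rewrite -eE.
  have : #|Y :&: Pi|%:R <= #|Pi|%:R :> R by rewrite ler_nat subset_leq_card // subsetIr.
  have : #|Y|%:R = #|Y :&: Pi|%:R + #|Y :\: Pi|%:R :> R by rewrite -natrD cardsID.
  by move: cY; rewrite -[s.+2]addn1 natrD; clear; move: #|Y|%:R (#|Pi|%:R : R) #|Y :&: Pi|%:R #|Y :\: Pi|%:R (s.+1%:R : R) E => a b c d e f; lra.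
exists (fun i => if unlift ord0 i is Some j then Z j else Y :&: Pi); split.
  move=> i; case: unliftP => [j|] _; last first.
    split; first exact: subsetIl.
    by move=> x y /setIP[_ xPi] /setIP[_ yPi]; apply: (pencil_intersecting k1 kn hPi).
  by have [h1 h2] := hZ j; split=> //; apply: subset_trans h1 _; exact: subsetDl.
rewrite big_ord_recl unlift_none (eq_bigr Z); last by move=> i _; rewrite liftK.
by rewrite -eZ setID.
Qed.

(** * Unions of stars, the competitors of a largest family *)

Definition star_union k (Ps : {set sp}) : {set sp} :=
  [set y in dsp k | [exists P in Ps, (P <= y)%VS]].

(** Choosing in each member a point of [Ps] is injective on pairwise disjoint members. *)
Lemma star_union_bounded k (Ps : {set sp}) : Ps \subset dsp 1 ->
  spread_bounded #|Ps| (star_union k Ps).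
Proof.
move=> Pp S SU hS; pose f y := odflt y [pick P in Ps | (P <= y)%VS].
have fP y : y \in S -> f y \in Ps /\ (f y <= y)%VS.
  move=> /(subsetP SU); rewrite inE => /andP[_ /exists_inP[P PP Py]].
  by rewrite /f; case: pickP => [Q /andP[]//|/(_ P)]; rewrite PP Py.
have f_inj : {in S &, injective f}.
  move=> x y xS yS e; apply/eqP; apply: contraT => /(hS x y xS yS) xy.
  have [fx fx'] := fP x xS; have [_ fy'] := fP y yS.
  have : (f x <= x :&: y)%VS by rewrite subv_cap fx' e fy'.
  rewrite xy subv0 -dimv_eq0; move: (subsetP Pp _ fx); rewrite in_dsp => /eqP ->.
  by [].
rewrite -(card_in_imset f_inj) subset_leq_card //; apply/subsetP => P /imsetP[y yS ->].
by have [] := fP y yS.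
Qed.

(** A Bonferroni-type bound from the first two moments of the number of points of [Ps] in a
    [k]-space. *)
Lemma card_star_union k (Ps : {set sp}) : (1 < k)%N -> Ps \subset dsp 1 ->
  #|Ps|%:R * gbin q n.-1 k.-1 - #|Ps|%:R ^+ 2 * gbin q (n - 2) (k - 2)
    <= #|star_union k Ps|%:R.
Proof.
move=> k1 Pp; rewrite /star_union card_filter_sum.
pose m y : R := \sum_(P in Ps) (P <= y)%VS%:R.
have k0 := ltnW k1.
set E := gbin q n.-1 k.-1; set L := gbin q (n - 2) (k - 2).
have L0 : 0 <= L by exact: gbin_ge0.
have m1 : \sum_(y in dsp k) m y = #|Ps|%:R * E.
  rewrite exchange_big /= mulr_natl -sumr_const; apply: eq_bigr => P PP.
  have := subsetP Pp _ PP; rewrite in_dsp => /eqP dP.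
  by rewrite sum_above dP ?subn1.
have m2 : \sum_(y in dsp k) m y ^+ 2 <= #|Ps|%:R * E + #|Ps|%:R ^+ 2 * L.
  under eq_bigr => y _ do rewrite /m expr2 mulr_suml.
  rewrite exchange_big /= expr2 -!mulrA -mulrDr mulr_natl -sumr_const.
  apply: ler_sum => P PP; under eq_bigr => y _ do rewrite mulr_sumr.
  have Pp' := subsetP Pp _ PP.
  rewrite exchange_big /= (bigD1 P PP) /=; apply: lerD.
    have := Pp'; rewrite in_dsp => /eqP dP; have := @sum_above R F n P k; rewrite dP !subn1.
    move=> /(_ k0); rewrite -/E => <-; apply: ler_sum => y _.
    by case: (P <= y)%VS; rewrite ?mulr0 ?mulr1.
  apply: le_trans (_ : \sum_(Q in Ps | Q != P) L <= _).
    apply: ler_sum => Q /andP[QP neq]; rewrite /L -(@deg_star k P Q) ?(subsetP Pp) // 1?eq_sym //.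
    rewrite /deg [leRHS](eq_bigl (fun y => (y \in dsp k) && (P <= y)%VS)); last by move=> y; rewrite !inE.
    rewrite [leRHS]big_mkcondr; apply: ler_sum => y _.
    by case: (P <= y)%VS; rewrite ?mul0r ?mul1r.
  rewrite mulr_natl -sumr_const big_mkcondr; apply: ler_sum => Q _.
  by case: ifP.
(* 2 m - m^2 <= 1 for every m, with value 0 at m = 0. *)
apply: le_trans (_ : \sum_(y in dsp k) (2 * m y - m y ^+ 2) <= _).
  by rewrite sumrB -mulr_sumr m1; clear -m2; lra.
apply: ler_sum => y yk; case: exists_inP => [_|h].
  by have := sqr_ge0 (m y - 1); rewrite sqrrB1 /= -mulr_natl; move: (m y) => t; lra.
suff -> : m y = 0 by rewrite mulr0 expr0n subrr.
rewrite /m big1 // => P PP; case Py : (P <= y)%VS => //.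
by case: h; exists P.
Qed.

End Induction.

(** * Numerical estimates *)

Section Numerics.
Variables (R : realFieldType) (p n k s m r : nat).
Local Notation q := (p%:R : R).
Local Notation "[ a ]q" := (qnum q a) (at level 0, a at level 99).
Hypotheses (p_gt1 : (1 < p)%N) (k_gt1 : (1 < k)%N) (s_gt1 : (1 < s)%N) (kn : (2 * k <= n)%N).
Hypothesis n_def : n = (m * k + r)%N.
Hypotheses (s3 : ((16 * s) ^ 3 <= p ^ (n - k - r))%N).
Hypotheses (s2 : ((16 * s) ^ 2 <= p ^ (n - 2 * k + 2))%N).

Let q_gt1 : 1 < q. Proof. by rewrite ltr1n. Qed.
Hint Resolve q_gt1 : core.

Lemma leq_cube a b : (a ^ 3 <= b ^ 3)%N -> (a <= b)%N.
Proof. by rewrite leq_exp2r. Qed.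

(** 8192 = 2 * 16^3, and s >= 2. *)
Lemma s_sqr_le : (8192 * s ^ 2 <= p ^ (n - k))%N.
Proof.
have h1 : (8192 * s ^ 2 <= (16 * s) ^ 3)%N.
  rewrite expnMn (expnS s 2) mulnA leq_mul2r; apply/orP; right.
  by rewrite (_ : 8192 = 16 ^ 3 * 2)%N // leq_mul2l.
apply: leq_trans h1 _; apply: leq_trans s3 _.
by rewrite leq_exp2l // leq_subr.
Qed.

(** By cases on e = n - 2k. For e = 0, 16 s <= p. For e = 1, p >= 3 gives p <= (p - 1)^2. For e >=
    2, e + 2 <= 2e already gives 16 s <= p^e. *)
Lemma s_le_gap : (15 * s <= p ^ (n - 2 * k) * p.-1)%N.
Proof.
have := s2; move: (n - 2 * k)%N => e; case: e => [|[|e]].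
- rewrite add0n leq_exp2r // expn0 mul1n.
  by move: s_gt1; clear; lia.
- rewrite expn1 => h.
  have p3 : (3 <= p)%N.
    rewrite ltnNge; apply/negP => p2; have e2 : p = 2%N by move: p_gt1 p2; clear; lia.
    move: h; rewrite e2; have : (32 <= 16 * s)%N by move: s_gt1; clear; lia.
    by move=> h1 h2; have := leq_trans (leq_mul h1 h1) h2.
  rewrite -(@leq_exp2r _ _ 2) //; apply: leq_trans (_ : p ^ (1 + 2) <= _)%N.
    by apply: leq_trans h; rewrite leq_exp2r // leq_mul2r orbT.
  rewrite expnMn (_ : (1 + 2 = 2.+1)%N) // expnSr leq_mul2l; apply/orP; right.
  by rewrite expnS expn1; case: (p) p3 => [|[|[|t]]] //= _; rewrite mulSn; clear; lia.
- move=> h; apply: leq_trans (_ : 16 * s <= _)%N; first by rewrite leq_mul2r orbT.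
  rewrite -(@leq_exp2r _ _ 2) //; apply: leq_trans h _.
  apply: leq_trans (_ : (p ^ e.+2) ^ 2 <= _)%N.
    by rewrite -expnM leq_exp2l //; clear; lia.
  by rewrite leq_exp2r // leq_pmulr //; move: p_gt1; clear; lia.
Qed.

Lemma qn_split : [n.-1]q = q ^+ (n - k) * [k.-1]q + [n - k]q.
Proof. by rewrite -qnumD //; congr qnum; move: k_gt1 kn; clear; lia. Qed.

Lemma qn_split' : [n]q = q ^+ (n - k) * [k]q + [n - k]q.
Proof. by rewrite -qnumD //; congr qnum; move: k_gt1 kn; clear; lia. Qed.

(** [s_le_gap] times [[k]q], with (q - 1)[k] = q^k - 1; the bounds on [kap] and [al] follow from
    it. *)
Lemma s_beta : s%:R * [k]q <= 1 / 15 * q ^+ (n - k).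
Proof.
have h : 15 * s%:R <= q ^+ (n - 2 * k) * (q - 1).
  have := s_le_gap; rewrite -(ler_nat R) !natrM natrX.
  by rewrite -subn1 natrB //; exact: ltnW.
have e : q ^+ (n - k) = q ^+ (n - 2 * k) * q ^+ k.
  by rewrite -exprD; congr (_ ^+ _); move: kn; clear; lia.
have k0 : 0 <= [k]q by exact: qnum_ge0.
have := ler_wpM2r k0 h.
rewrite -[X in _ <= X]mulrA qnumE // e.
have := qX_gt0 q_gt1 (n - 2 * k).
by move: (q ^+ (n - 2 * k)) (q ^+ k) [k]q (s%:R : R) => a b c d; lra.
Qed.

Lemma s_kappa : s%:R * ([k]q ^+ 2 / [n]q) <= 1 / 15.
Proof.
have n0 : 0 < [n]q by apply: qnum_gt0 => //; move: k_gt1 kn; clear; lia.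
rewrite mulrA ler_pdivrMr // qn_split'.
have k0 : 0 <= [k]q by exact: qnum_ge0.
have := ler_wpM2r k0 s_beta; have : 0 <= [n - k]q by exact: qnum_ge0.
by rewrite expr2; lra.
Qed.

Lemma s_alpha : s%:R * ([k]q * [k.-1]q / [n.-1]q) <= 1 / 15.
Proof.
have n0 : 0 < [n.-1]q by apply: qnum_gt0 => //; move: k_gt1 kn; clear; lia.
rewrite mulrA ler_pdivrMr // qn_split.
have k0 : 0 <= [k.-1]q by exact: qnum_ge0.
have := ler_wpM2r k0 s_beta; have : 0 <= [n - k]q by exact: qnum_ge0.
lra.
Qed.

(** Here m <= 3, so n - k - r <= 2k, while 90^2 <= 2 * 16^3 gives (90 s)^2 <= (16 s)^3. *)
Lemma s_small_k : (n < 4 * k)%N -> s%:R <= 1 / 90 * q ^+ k.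
Proof.
move=> n4; have h : (90 * s <= p ^ k)%N.
  rewrite -(@leq_exp2r _ _ 2) // -expnM; apply: leq_trans (_ : (16 * s) ^ 3 <= _)%N.
    rewrite !expnMn (expnS s 2) mulnA leq_mul2r; apply/orP; right.
    by apply: leq_trans (_ : 16 ^ 3 * 2 <= _)%N; rewrite // leq_mul2l.
  apply: leq_trans s3 _; rewrite leq_exp2l // n_def.
  have : (m < 4)%N.
    rewrite ltnNge; apply/negP => m4; move: n4; rewrite n_def ltnNge => /negP; apply.
    by apply: leq_trans (leq_addr _ _); rewrite leq_mul2r m4 orbT.
  by case: m => [|[|[|[|]]]] // _; clear; lia.
by move: h; rewrite -(ler_nat R) natrM natrX; lra.
Qed.

(** n >= 4k gives n - k - r <= 3(n - 3k), hence 16 s <= q^(n - 3k); this absorbs [k]^2 <= q^(2k)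
    against q^(n - k). *)
Lemma s_large : (4 * k <= n)%N -> s%:R * [k]q * ([k]q * [k.-1]q / [n.-1]q) <= 1 / 4.
Proof.
move=> n4; have h : (16 * s <= p ^ (n - 3 * k))%N.
  apply: leq_cube; apply: leq_trans s3 _; rewrite -expnM leq_exp2l //.
  by move: n4; clear; lia.
have n0 : 0 < [n.-1]q by apply: qnum_gt0 => //; move: k_gt1 kn; clear; lia.
rewrite mulrA ler_pdivrMr // qn_split.
have k0 : 0 <= [k.-1]q by exact: qnum_ge0.
have kk : 0 <= [k]q by exact: qnum_ge0.
have kq : [k]q <= q ^+ k.
  have := qnumE q_gt1 k; have q2 : 2 <= q by rewrite ler_nat.
  have : 0 <= (q - 2) * [k]q by rewrite mulr_ge0 // subr_ge0.
  by lra.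
have e : q ^+ (n - k) = q ^+ (n - 3 * k) * (q ^+ k * q ^+ k).
  by rewrite -!exprD; congr (_ ^+ _); move: n4; clear; lia.
have h2 : [k]q * [k]q <= q ^+ k * q ^+ k by exact: ler_pM.
have h3 : 16 * s%:R <= q ^+ (n - 3 * k) by rewrite -natrX -natrM ler_nat.
have h4 : s%:R * ([k]q * [k]q) <= s%:R * (q ^+ k * q ^+ k) by rewrite ler_wpM2l ?ler0n.
have qk0 : 0 <= q ^+ k * q ^+ k by rewrite mulr_ge0 ?(ltW (qX_gt0 q_gt1 _)).
have h5 := ler_wpM2r qk0 h3.
have h6 : 16 * (s%:R * ([k]q * [k]q)) <= q ^+ (n - k) by rewrite e; lra.
have h7 := ler_wpM2r k0 h6.
have h8 : 0 <= [n - k]q by exact: qnum_ge0.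
have h9 : 0 <= q ^+ (n - k) * [k.-1]q by rewrite mulr_ge0 ?(ltW (qX_gt0 q_gt1 _)).
by lra.
Qed.

Lemma qk_split : [k]q = q * [k.-1]q + 1.
Proof. by rewrite -{1}(prednK (ltnW k_gt1)) qnumS. Qed.

Lemma qk1_split : [k.-1]q = q * [k - 2]q + 1.
Proof.
have -> : k.-1 = (k - 2).+1 by move: k_gt1; clear; lia.
by rewrite qnumS.
Qed.

Lemma qnk_split : [n - k.-1]q = q * [n - k]q + 1.
Proof.
have -> : (n - k.-1 = (n - k).+1)%N by move: k_gt1 kn; clear; lia.
by rewrite qnumS.
Qed.

Lemma threshold_self : [k]q <= 1 / 100 * ([k.-1]q * [n - k.-1]q).
Proof.
(* Small q uses [s_sqr_le] with s >= 2; for q > 100, q^2 suffices. *)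
have h1 : (100 * p.+1 <= p ^ (n - k))%N.
  have h : (32768 <= p ^ (n - k))%N.
    by apply: leq_trans s_sqr_le; rewrite (_ : 32768 = 8192 * 2 ^ 2)%N // leq_mul2l leq_exp2r.
  case: (leqP p 100) => p100.
    by apply: leq_trans h; apply: leq_trans (_ : 100 * 101 <= _)%N; rewrite // leq_mul2l.
  apply: leq_trans (_ : p ^ 2 <= _)%N; last first.
    by rewrite leq_exp2l //; move: k_gt1 kn; clear; lia.
  rewrite expnS expn1; apply: leq_trans (_ : 101 * p <= _)%N; last by rewrite leq_mul2r p100 orbT.
  by move: p100; clear; lia.
have h2 : 100 * (q + 1) <= [n - k.-1]q.
  apply: le_trans (_ : q ^+ (n - k) <= _).
    by have := h1; rewrite -(ler_nat R) natrM natrX -[p.+1]addn1 natrD.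
  have -> : (n - k.-1 = (n - k).+1)%N by move: k_gt1 kn; clear; lia.
  exact: qnum_ge_expr.
have u1 : 1 <= [k.-1]q.
  rewrite qk1_split; have : 0 <= q * [k - 2]q by rewrite mulr_ge0 ?ler0n ?qnum_ge0.
  lra.
have u0 : 0 <= [k.-1]q by apply: le_trans u1.
have := ler_wpM2l u0 h2; rewrite qk_split.
move: u1; move: [k.-1]q [n - k.-1]q => a b; lra.
Qed.

(** q * X <= M and q^(n - 2k) * W <= M. For q >= 6 this gives X + 2W <= M/2. For q <= 5, [s2] forces
    q^(n - 2k) >= 40, and M/2 + M/20 is still below 6/10 M. *)
Lemma threshold_gap : (2 * k < n)%N ->
  [k - 2]q * (q * [n - k]q) + 2 * ([k]q * (q * [k.-1]q))
    < 6 / 10 * ([k.-1]q * [n - k.-1]q).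
Proof.
move=> n2k; set X := [k - 2]q * _; set W := [k]q * _; set M := [k.-1]q * _.
have a0 := qnum_ge0 q_gt1 (k - 2); have b0 := qnum_ge0 q_gt1 (n - k).
have k0 : 0 <= [k.-1]q by exact: qnum_ge0.
have q0 : 0 < q by exact: lt_trans q_gt1.
have M0 : 0 < M by apply: mulr_gt0; apply: qnum_gt0 => //; move: k_gt1 kn; clear; lia.
have X0 : 0 <= X by rewrite mulr_ge0 // mulr_ge0 // ltW.
have W0 : 0 <= W by rewrite mulr_ge0 ?qnum_ge0 // mulr_ge0 // ltW.
have hX : q * X <= M.
  rewrite /M qk1_split qnk_split /X.
  have := mulr_ge0 (ltW q0) a0; have := mulr_ge0 (ltW q0) b0.
  move: [k - 2]q [n - k]q => a b; lra.
have hW : q ^+ (n - 2 * k) * W <= M.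
  have -> : q ^+ (n - 2 * k) * W = [k.-1]q * (q ^+ (n - 2 * k).+1 * [k]q).
    by rewrite /W exprS; ring.
  rewrite /M ler_wpM2l //.
  have -> : (n - k.-1 = k + (n - 2 * k).+1)%N by move: k_gt1 kn; clear; lia.
  by rewrite qnumD // lerDl qnum_ge0.
case: (leqP 6 p) => p6.
  have q6 : 6 <= q by rewrite (ler_nat R 6).
  have hW' : q * W <= M.
    apply: le_trans hW; rewrite ler_wpM2r //.
    have -> : (n - 2 * k = (n - 2 * k).-1.+1)%N by move: n2k; clear; lia.
    by rewrite exprS ler_peMr ?(ltW q0) // qX_ge1.
  have h1 : 6 * X <= q * X by rewrite ler_wpM2r.
  have h2 : 6 * W <= q * W by rewrite ler_wpM2r.
  by lra.
have e40 : (40 <= p ^ (n - 2 * k))%N.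
  have h : (1024 <= p ^ (n - 2 * k + 2))%N.
    apply: leq_trans s2; rewrite (_ : 1024 = 32 ^ 2)%N // leq_exp2r //.
    by move: s_gt1; clear; lia.
  rewrite leqNgt; apply/negP => h'; move: h; rewrite expnD leqNgt => /negP; apply.
  have : (p ^ 2 <= 25)%N by rewrite (_ : 25 = 5 ^ 2)%N // leq_exp2r.
  move: h'; rewrite ltnS => h' h''.
  by apply: leq_ltn_trans (leq_mul h' h'') _.
have q40 : 40 <= q ^+ (n - 2 * k) by rewrite -natrX (ler_nat R 40).
have q2 : 2 <= q by rewrite (ler_nat R 2).
have h1 : 2 * X <= q * X by rewrite ler_wpM2r.
have h2 : 40 * W <= q ^+ (n - 2 * k) * W by rewrite ler_wpM2r.
by lra.
Qed.

(** Now [s2] reads 16 s <= q, so q >= 32. The left side is about 4 q [k-1]^2, the right about 6/10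
    q^2 [k-1]^2. *)
Lemma threshold_nogap : n = (2 * k)%N ->
  [k - 2]q * (q * [k]q) + 2 * ([k.-1]q * (q * [k.-1]q)) + [k]q * (q * [k - 2]q)
    < 6 / 10 * ([k.-1]q * [n - k.-1]q).
Proof.
move=> n2k; have nk : (n - k = k)%N by rewrite n2k; clear; lia.
rewrite qnk_split nk.
have q32 : 32 <= q.
  rewrite (ler_nat R 32); have := s2; rewrite n2k subnn add0n leq_exp2r // => h.
  by apply: leq_trans h; move: s_gt1; clear; lia.
have u0 := qnum_ge0 q_gt1 (k - 2).
have -> : [k]q = q * [k.-1]q + 1 by exact: qk_split.
have := qk1_split; move: (q : R) q32 [k - 2]q u0 [k.-1]q => t t32 a a0 u eu.
have t0 : 0 <= t by lra.
have u1 : 1 <= u by rewrite eu; have := mulr_ge0 t0 a0; lra.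
have eta : t * a = u - 1 by rewrite eu; ring.
have -> : a * (t * (t * u + 1)) + 2 * (u * (t * u)) + (t * u + 1) * (t * a) =
  2 * (t * a) * (t * u + 1) + 2 * t * (u * u) by ring.
rewrite eta.
have p1 : 0 <= (t - 32) * (t * (u * u)) by rewrite !mulr_ge0 //; lra.
have p2 : 0 <= (t - 32) * u by rewrite mulr_ge0 //; lra.
have p3 : 0 <= t * (u * u) by rewrite !mulr_ge0 //; lra.
lra.
Qed.

End Numerics.

(** * The theorem *)

Section Bridge.
Variables (F : finFieldType) (n : nat).
Local Notation sp := {vspace 'rV[F]_n}.
Local Notation dsp := (@dsp F n).
Implicit Types (Y Z A : {set sp}) (k s : nat).

Lemma EM_spread_bounded s k Y : EM_family s k Y -> spread_bounded s Y.
Proof.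
move=> [_ hno] S SY hS; rewrite leqNgt; apply/negP => sS; apply: hno.
have [l [Ul sl lS]] := card_geqP sS.
have lS' : [set x in l] \subset S by apply/subsetP => x; rewrite inE; exact: lS.
exists [set x in l]; split.
- exact: subset_trans lS' SY.
- by rewrite cardsE (card_uniqP Ul) sl.
- move=> U W UA WA /eqP UW; apply: hS => //; exact: (subsetP lS').
Qed.

Lemma spread_bounded_EM s k Y : Y \subset dsp k -> spread_bounded s Y -> EM_family s k Y.
Proof.
move=> Yk Ys; split=> [U /(subsetP Yk)|[A [AY cA hA]]]; first by rewrite in_dsp => /eqP.
have hA' : partial_spread A by move=> U W UA WA /eqP UW; apply: hA.
by have := Ys A AY hA'; rewrite cA ltnn.
Qed.

(** Distinct points are disjoint, so [Y] has at most [s] members and is split into singletons and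
    empty parts. *)
Lemma EM_points_cover s Y : EM_family s 1 Y ->
  exists Z : 'I_s -> {set sp}, (forall i, intersecting_family 1 (Z i)) /\ Y = \bigcup_(i < s) Z i.
Proof.
move=> hY; have [Y1 _] := hY; have Ys := EM_spread_bounded hY.
have cY : (#|Y| <= s)%N.
  apply: Ys => // x y xY yY xy; apply/eqP; rewrite -dimv_eq0; apply: contraT => d0.
  have d1 : (0 < \dim (x :&: y))%N by rewrite lt0n.
  have /eqP e1 : (x :&: y == x)%VS by rewrite eqEdim capvSl Y1.
  have /eqP e2 : (x :&: y == y)%VS by rewrite eqEdim capvSr Y1.
  by move: xy; rewrite -e1 e2 eqxx.
exists (fun i => [set y in Y | index y (enum Y) == i :> nat]); split.
  move=> i; split=> [U|U W]; rewrite !inE; first by move=> /andP[/Y1].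
  move=> /andP[UY /eqP Ui] /andP[WY /eqP Wi].
  have -> : W = U.
    by rewrite -(nth_index U (_ : W \in enum Y)) ?mem_enum // Wi -Ui nth_index ?mem_enum.
  by rewrite /meetv /disjointv capvv => /(congr1 (fun A : sp => \dim A)); rewrite Y1 // dimv0.
apply/setP => y; apply/idP/bigcupP => [yY|[i _]]; last by rewrite inE => /andP[].
have iy : (index y (enum Y) < s)%N.
  by apply: leq_trans cY; rewrite cardE index_mem mem_enum.
by exists (Ordinal iy) => //; rewrite inE yY eqxx.
Qed.

End Bridge.

Section Assembly.
Variables (R : realFieldType) (F : finFieldType) (n k m r : nat).
Local Notation sp := {vspace 'rV[F]_n}.
Local Notation q := (#|F|%:R : R).
Local Notation "[ a ]q" := (qnum q a) (at level 0, a at level 99).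
Local Notation dsp := (@dsp F n).
Implicit Types (Y Z A : {set sp}) (s : nat).
Hypotheses (k_gt1 : (1 < k)%N) (kn : (2 * k <= n)%N).
Hypothesis n_def : n = (m * k + r)%N.

Let E := gbin q n.-1 k.-1.
Let al := [k]q * [k.-1]q / [n.-1]q.

Lemma find_pencil s Y : (1 < s)%N ->
  ((16 * s) ^ 3 <= #|F| ^ (n - k - r))%N -> ((16 * s) ^ 2 <= #|F| ^ (n - 2 * k + 2))%N ->
  Y \subset dsp k -> spread_bounded s Y -> (s%:R - 1 / 1000) * E <= #|Y|%:R ->
  exists2 Pi, is_pencil k Pi & s%:R * al * E < #|Y :&: Pi|%:R.
Proof.
move=> s1 s3 s2 Yk Ys cY; have F1 : (1 < #|F|)%N by exact: finNzRing_gt1.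
have q1 : 1 < q by rewrite ltr1n.
case: (ltnP n (4 * k)) => n4.
  apply: (@find_pencil_small R F n k s Y E ([k]q ^+ 2 / [n]q) al
    ([k.-1]q * [n - k.-1]q)) => //.
  - by apply: (@s_kappa R #|F| n k s).
  - by apply: (@s_alpha R #|F| n k s).
  - by apply: (@s_small_k R #|F| n k s m r).
  - by apply: (@threshold_self R #|F| n k s r).
  - by apply: (@threshold_gap R #|F| n k s).
  - by apply: (@threshold_nogap R #|F| n k s).
apply: (@find_pencil_large R F n k s Y E al) => //; try exact: ltnW.
- by apply: gbin_gt0 => //; move: k_gt1 kn; clear; lia.
- by apply: divr_ge0; [apply: mulr_ge0|]; apply: qnum_ge0.
- by apply: (@s_large R #|F| n k s r).
Qed.

(** Comparison with the union of [s] stars, whose overlap term s^2 * L is at most E / 8192 because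
    q^(n - k) * L <= E. *)
Lemma largest_EM_card s Y : (1 < s)%N -> ((16 * s) ^ 3 <= #|F| ^ (n - k - r))%N ->
  largest_EM_family s k Y -> (s%:R - 1 / 1000) * E <= #|Y|%:R.
Proof.
move=> s1 s3 [_ Ymax]; have F1 : (1 < #|F|)%N by exact: finNzRing_gt1.
have q1 : 1 < q by rewrite ltr1n.
have h : (8192 * s ^ 2 <= #|F| ^ (n - k))%N by apply: (@s_sqr_le _ _ k s r).
have sn : (s <= #|dsp 1|)%N.
  rewrite -(ler_nat R) card_pts.
  apply: le_trans (_ : q ^+ n.-1 <= _); last first.
    have e : n = n.-1.+1 by move: k_gt1 kn; clear; lia.
    by rewrite [in leRHS]e qnum_ge_expr.
  rewrite -natrX ler_nat; apply: leq_trans (_ : #|F| ^ (n - k) <= _)%N; last first.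
    by rewrite leq_exp2l //; move: k_gt1; clear; lia.
  apply: leq_trans h; rewrite expnS expn1 mulnA leq_pmull // muln_gt0 /=.
  exact: ltnW.
have [l [Ul sl lS]] := card_geqP sn.
pose Ps := [set P in l].
have cPs : #|Ps| = s by rewrite cardsE (card_uniqP Ul) sl.
have PsP : Ps \subset dsp 1 by apply/subsetP => x; rewrite inE; exact: lS.
have Uk : star_union k Ps \subset dsp k by apply/subsetP => y; rewrite inE => /andP[].
have Us := star_union_bounded (k := k) PsP; rewrite cPs in Us.
have := Ymax _ (spread_bounded_EM Uk Us); rewrite -(ler_nat R); apply: le_trans.
apply: le_trans (card_star_union R k_gt1 PsP); rewrite cPs -/E.
set L := gbin q (n - 2) (k - 2).
have L0 : 0 <= L by exact: gbin_ge0.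
have eL : E * [k.-1]q = [n.-1]q * L.
  rewrite /E /L; have -> : k.-1 = (k - 2).+1 by move: k_gt1; clear; lia.
  by rewrite gbin_absorb //; congr (_ * gbin _ _ _); clear; lia.
have k10 : 0 < [k.-1]q by apply: qnum_gt0 => //; move: k_gt1; clear; lia.
have LE : q ^+ (n - k) * L <= E.
  rewrite -(ler_pM2r k10) eL (@qn_split R #|F| n k) //.
  by rewrite -subr_ge0; have := mulr_ge0 (qnum_ge0 q1 (n - k)) L0; lra.
have sL : 8192 * s%:R ^+ 2 * L <= E.
  apply: le_trans LE; rewrite ler_wpM2r //.
  by move: h; rewrite -(ler_nat R) natrM !natrX.
have E0 : 0 <= E by exact: gbin_ge0.
by move: sL E0; move: (s%:R ^+ 2 * L) (mulrA 8192 (s%:R ^+ 2) L) => X <-; lra.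
Qed.

Lemma largest_EM_union s Y :
  ((16 * s) ^ 3 <= #|F| ^ (n - k - r))%N -> ((16 * s) ^ 2 <= #|F| ^ (n - 2 * k + 2))%N ->
  (0 < s)%N -> largest_EM_family s k Y ->
  exists Z : 'I_s -> {set sp},
    (forall i, intersecting_family k (Z i)) /\ Y = \bigcup_(i < s) Z i.
Proof.
move=> s3 s2 s0 Ymax; have [hY _] := Ymax; have [Yk' _] := hY.
have Yk : Y \subset dsp k by apply/subsetP => y /Yk'; rewrite in_dsp => ->.
have Ys := EM_spread_bounded hY.
(* For s = 1 no lower bound on [#|Y|] is needed, and tau = 1 makes it vacuous. *)
pose tau : R := if (1 < s)%N then 1 / 1000 else 1.
have cY : (s%:R - tau) * E <= #|Y|%:R.
  rewrite /tau; case: ifP => s1; first exact: largest_EM_card.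
  have -> : s = 1%N by move: s0 s1; clear; lia.
  by rewrite subrr mul0r ler0n.
have [|Z [hZ eZ]] := @intersecting_cover R F n k s Y E al tau k_gt1 kn Yk erefl erefl _ Ys cY.
  move=> s' Y' /andP[s'1 s's] Y'k Y's; rewrite /tau (leq_trans s'1 s's).
  apply: find_pencil => //.
    by apply: leq_trans s3; rewrite leq_exp2r // leq_mul2l s's orbT.
  by apply: leq_trans s2; rewrite leq_exp2r // leq_mul2l s's orbT.
exists Z; split=> // i; have [ZY intZ] := hZ i; split.
  by move=> U /(subsetP ZY) /Yk'.
by move=> U W UZ WZ; apply/eqP; apply: intZ.
Qed.

End Assembly.

Theorem theorem1p5 (R : realType) (F : finFieldType) (q n k s m r : nat)
    (l : int) (Y : {set {vspace 'rV[F]_n}})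
    (q_def : q = #|F|)
    (n_gt0 : (0 < n)%N) (k_gt0 : (0 < k)%N) (s_gt0 : (0 < s)%N)
    (n_ge2k : (2 * k <= n)%N)
    (n_def : n = (m * k + r)%N) (r_lt : (r < k)%N)
    (l_def : gauss_nat (q%:R : R) (l - 1) < s%:R <= gauss_nat (q%:R : R) l)
    (Y_largest : largest_EM_family s k Y)
    (s_small : 16 * s%:R <=
       Num.min (q%:R `^ ((n%:R - k%:R - l%:~R + 2) / 3) : R)
         (Num.min (q%:R `^ ((n%:R - k%:R - r%:R) / 3))
                  (q%:R `^ (n%:R / 2 - k%:R + 1)))) :
  exists Z : 'I_s -> {set {vspace 'rV[F]_n}},
    (forall i, intersecting_family k (Z i)) /\ Y = \bigcup_(i < s) Z i.
Proof.
have [k1|k1] := leqP k 1.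
  have e : k = 1%N by move: k_gt0 k1; clear; lia.
  by rewrite e in Y_largest *; apply: EM_points_cover; case: Y_largest.
move: s_small; rewrite !le_min => /andP[_ /andP[h3 h2]].
have s0 : 0 <= 16 * s%:R :> R by rewrite mulr_ge0 ?ler0n.
(* Raising to the power [a] clears the denominator of the real exponent. *)
have pow_nat (x : R) (a b : nat) : 16 * s%:R <= q%:R `^ x -> x * a%:R = b%:R ->
    ((16 * s) ^ a <= q ^ b)%N.
  move=> h e; rewrite -(ler_nat R) !natrX natrM.
  apply: le_trans (_ : (q%:R `^ x) ^+ a <= _); first by rewrite lerXn2r ?nnegrE ?powR_ge0.
  by rewrite -powR_mulrn ?powR_ge0 // -powRrM e powR_mulrn.
rewrite q_def in h3 h2 pow_nat.
(* n >= 2k and r < k force m >= 2, so the natural subtraction n - k - r does not truncate. *)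
have kr : (k + r <= n)%N.
  move: n_ge2k r_lt; rewrite n_def; clear; case: m => [|[|m']]; [lia|lia|].
  by rewrite !mulSn; move: (m' * k)%N => t; lia.
have c3 : ((16 * s) ^ 3 <= #|F| ^ (n - k - r))%N.
  apply: (pow_nat _ 3 _ h3); rewrite divfK ?pnatr_eq0 // -subnDA natrB // natrD.
  by ring.
have c2 : ((16 * s) ^ 2 <= #|F| ^ (n - 2 * k + 2))%N.
  by apply: (pow_nat _ 2 _ h2); rewrite natrD natrB // natrM; field.
exact: (@largest_EM_union R F n k m r k1 n_ge2k n_def s Y c3 c2 s_gt0 Y_largest).
Qed.
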